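(* Let $H=(V,E,w)$ be a hypergraph as in the context, with $r$ the size of its largest hyperedge. (a) Suppose $f_1,\dots,f_k$ are $k$ vectors orthonormal with respect to $\langle\cdot,\cdot\rangle_w$ with $\max_{s\in[k]}\mathcal{D}_w(f_s)\le\xi$. There is a randomized procedure running in polynomial time such that for every $\epsilon\ge\frac1k$, with probability $\Omega(1)$, it returns $\lfloor(1-\epsilon)k\rfloor$ nonempty disjoint sets $S_1,\dots,S_{\lfloor(1-\epsilon)k\rfloor}\subset V$ with $$\max_{i}\phi(S_i)=O\!\left(\frac{k^2}{\epsilon^{1.5}}\log\frac{k}{\epsilon}\log\log\frac{k}{\epsilon}\sqrt{\log r}\cdot\sqrt{\xi}\right).$$ (b) For any $k$ disjoint nonempty sets $S_1,\dots,S_k\subset V$, $\max_{i\in[k]}\phi(S_i)\ge\frac{\zeta_k}{2}$.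
   Context: $H=(V,E,w)$: $V$ finite, hyperedges nonempty subsets of $V$, $w_e\ge0$; vertex weights $w_v=\sum_{e\ni v}w_e>0$; $w(S)=\sum_{v\in S}w_v$; $\partial S$ the set of hyperedges meeting both $S$ and $V\setminus S$; $\phi(S)=\sum_{e\in\partial S}w_e/w(S)$. $\langle f,g\rangle_w=\sum_vw_vf_vg_v$. $\mathcal{D}_w(f)=\frac{\sum_{e\in E}w_e\max_{u,v\in e}(f_u-f_v)^2}{\sum_uw_uf_u^2}$ for $f\neq0$. $\zeta_k=\min_{f_1,\dots,f_k}\max\{\mathcal{D}_w(f):0\ne f\in\mathrm{span}\{f_1,\dots,f_k\}\}$, the minimum over $k$ nonzero vectors that are mutually orthogonal with respect to $\langle\cdot,\cdot\rangle_w$. *)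

(* Defs.v *)
From HB Require Import structures.
From mathcomp Require Import all_boot all_order all_algebra.
From mathcomp Require Import all_classical all_reals.
From mathcomp Require Import exp.

Set Implicit Arguments.
Unset Strict Implicit.
Unset Printing Implicit Defensive.

Import Order.TTheory GRing.Theory Num.Theory.
Local Open Scope ring_scope.

(** * Weighted hypergraphs *)

Record hypergraph (R : realType) (V : finType) := Hypergraph {
  edges : {set {set V}};
  weight : {set V} -> R;
  edges_neq0 : forall e, e \in edges -> e != finset.set0;
  weight_ge0 : forall e, e \in edges -> 0 <= weight e;
  degree_gt0 : forall v, 0 < \sum_(e in edges | v \in e) weight e
}.

(* The codomain is [R^o] so that the canonical [vectType R] structure, hence
   [span], is available. *)
Notation vec R V := {ffun V -> (R : realType)^o}.

Section Hypergraph.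
Variables (R : realType) (V : finType) (H : hypergraph R V).
Implicit Types (S : {set V}) (f g : vec R V).

Definition vweight (v : V) : R := \sum_(e in edges H | v \in e) weight H e.

Definition volume S : R := \sum_(v in S) vweight v.

Definition boundary S : {set {set V}} :=
  [set e in edges H | ~~ [disjoint e & S] && ~~ [disjoint e & ~: S]]%SET.

Definition expansion S : R := (\sum_(e in boundary S) weight H e) / volume S.

Definition edge_rank : nat := \max_(e in edges H) #|e|.

Definition inner f g : R := \sum_v vweight v * f v * g v.

(* The base point 0 of the iterated maximum is harmless: the terms are
   nonnegative and hyperedges are nonempty. *)
Definition edge_max f (e : {set V}) : R :=
  \big[Num.max/0]_(u in e) \big[Num.max/0]_(v in e) (f u - f v) ^+ 2.

Definition discrepancy f : R :=
  (\sum_(e in edges H) weight H e * edge_max f e) /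
  (\sum_u vweight u * f u ^+ 2).

Definition orthonormal_family k (fs : k.-tuple (vec R V)) : Prop :=
  forall i j : 'I_k, inner (tnth fs i) (tnth fs j) = (i == j)%:R.

Definition nonzero_orthogonal k (fs : k.-tuple (vec R V)) : Prop :=
  (forall i : 'I_k, tnth fs i != 0) /\
  (forall i j : 'I_k, i != j -> inner (tnth fs i) (tnth fs j) = 0).

Definition max_discrepancy k (fs : k.-tuple (vec R V)) : R :=
  sup [set x : R | exists f, [/\ f != 0, f \in <<fs>>%VS & x = discrepancy f]]%classic.

(* [discrepancy] takes its values in [0, 2], so for 0 < k <= #|V| both the
   supremum above and the infimum below range over nonempty bounded sets; they
   are attained, by compactness of unit spheres and of the set of orthonormal
   families. *)
Definition zeta k : R :=
  inf [set x : R | exists fs : k.-tuple (vec R V),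
                     nonzero_orthogonal fs /\ x = max_discrepancy fs]%classic.

End Hypergraph.

(** * Randomized real-RAM programs

    A program works on arrays of natural numbers and arrays of exact reals.  An
    array is designated by a constant, and its cells by two computed indices.
    Each step has unit cost.  The only arithmetic on naturals is addition and
    truncated subtraction; reals have the field operations, square roots and
    comparisons, but no rounding to an integer.  Randomness comes from fair
    coin flips.  The syntax contains no real constant. *)

Inductive nexp : Type :=
| NConst of nat
| NGet of nat & nexp & nexp
| NAdd of nexp & nexp
| NSub of nexp & nexp.

Inductive rexp : Type :=
| ROfNat of nexp
| RGet of nat & nexp & nexp
| RAdd of rexp & rexp
| RSub of rexp & rexp
| RMul of rexp & rexp
| RDiv of rexp & rexp
| RSqrt of rexp.

Inductive bexp : Type :=
| BNatLt of nexp & nexp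
| BRealLt of rexp & rexp
| BNot of bexp
| BAnd of bexp & bexp.

Inductive cmd : Type :=
| Skip
| NSet of nat & nexp & nexp & nexp
| RSet of nat & nexp & nexp & rexp
| Flip of nat & nexp & nexp
| Seq of cmd & cmd
| If of bexp & cmd & cmd
| While of bexp & cmd.

Definition memory (T : Type) := nat -> nat -> nat -> T.

Definition update T (m : memory T) (a i j : nat) (x : T) : memory T :=
  fun a' i' j' => if [&& a' == a, i' == i & j' == j] then x else m a' i' j'.

Section Machine.
Variable R : realType.

Record store := Store { nmem : memory nat; rmem : memory R }.

Fixpoint neval (s : store) (e : nexp) : nat :=
  match e with
  | NConst n => n
  | NGet a i j => nmem s a (neval s i) (neval s j)
  | NAdd e1 e2 => (neval s e1 + neval s e2)%N
  | NSub e1 e2 => (neval s e1 - neval s e2)%N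
  end.

Fixpoint reval (s : store) (e : rexp) : R :=
  match e with
  | ROfNat n => (neval s n)%:R
  | RGet a i j => rmem s a (neval s i) (neval s j)
  | RAdd e1 e2 => reval s e1 + reval s e2
  | RSub e1 e2 => reval s e1 - reval s e2
  | RMul e1 e2 => reval s e1 * reval s e2
  | RDiv e1 e2 => reval s e1 / reval s e2
  | RSqrt e1 => Num.sqrt (reval s e1)
  end.

Fixpoint beval (s : store) (b : bexp) : bool :=
  match b with
  | BNatLt e1 e2 => (neval s e1 < neval s e2)%N
  | BRealLt e1 e2 => reval s e1 < reval s e2
  | BNot b1 => ~~ beval s b1
  | BAnd b1 b2 => beval s b1 && beval s b2
  end.

(* [todo] is the stack of commands still to be executed, [coins] the part of
   the random tape not read yet. *)
Record config := Config { todo : seq cmd; cur_store : store; coins : seq bool }.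

Definition step (c : config) : config :=
  let: Config k s w := c in
  match k with
  | [::] => c
  | Skip :: k' => Config k' s w
  | NSet a i j e :: k' =>
      Config k' (Store (update (nmem s) a (neval s i) (neval s j) (neval s e))
                       (rmem s)) w
  | RSet a i j e :: k' =>
      Config k' (Store (nmem s)
                       (update (rmem s) a (neval s i) (neval s j) (reval s e))) w
  | Flip a i j :: k' =>
      Config k' (Store (update (nmem s) a (neval s i) (neval s j)
                               (nat_of_bool (head false w)))
                       (rmem s)) (behead w)
  | Seq p q :: k' => Config [:: p, q & k'] s w
  | If b p q :: k' => Config ((if beval s b then p else q) :: k') s w
  | While b p :: k' =>
      Config (if beval s b then [:: p, While b p & k'] else k') s w
  end.

Definition run (P : cmd) (s : store) (t : nat) (w : seq bool) : config :=
  iter t step (Config [:: P] s w).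

Definition halted (c : config) : bool := nilp (todo c).

(* A run of t steps reads at most t coins, so a uniform tape of length t
   describes all its randomness. *)
Definition coin_probability (t : nat) (A : pred (seq bool)) : R :=
  #|[set w : t.-tuple bool | A w]%SET|%:R / 2 ^+ t.

Section InputOutput.
Variables (V : finType) (H : hypergraph R V).

(* Vertices and hyperedges are numbered by [enum].  Integer arrays: array 0
   contains #|V|, #|E|, k and array 1 the incidence matrix.  Real arrays:
   array 0 contains the hyperedge weights, array 1 the coordinates of the
   vectors and array 2 the number [eps].  All other cells contain 0. *)
Definition input_nmem (k : nat) : memory nat := fun a i j =>
  match a with
  | 0%N => if i == 0%N then nth 0%N [:: #|V|; #|edges H|; k] j else 0%N
  | 1%N => nth 0%N [seq nat_of_bool (v \in nth finset.set0 (enum (edges H)) i)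
                   | v <- enum V] j
  | _ => 0%N
  end.

Definition input_rmem (k : nat) (fs : k.-tuple (vec R V)) (eps : R) :
    memory R := fun a i j =>
  match a with
  | 0%N => if i == 0%N then nth 0 [seq weight H e | e <- enum (edges H)] j else 0
  | 1%N => nth 0 [seq (nth 0 fs i : vec R V) v | v <- enum V] j
  | 2%N => if (i == 0%N) && (j == 0%N) then eps else 0
  | _ => 0
  end.

Definition input (k : nat) (fs : k.-tuple (vec R V)) (eps : R) : store :=
  Store (input_nmem k) (input_rmem fs eps).

Definition input_size (k : nat) : nat := (#|V| + #|edges H| + k)%N.

(* On halting, the cell (0, 0, 0) contains the number of sets returned, and
   row i of the integer array 1 is the indicator of the i-th set. *)
Definition output (s : store) : seq {set V} :=
  [seq [set v : V | nmem s 1 i (enum_rank v) != 0%N]%SET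
  | i <- iota 0 (nmem s 0 0 0)].

End InputOutput.
End Machine.

Section Guarantee.
Variables (R : realType) (V : finType) (H : hypergraph R V).

(* [Num.truncn x] is the floor of x when x >= 0, and 0 otherwise. *)
Definition good_sets (k : nat) (eps bound : R) (Ss : seq {set V}) : bool :=
  [&& size Ss == Num.truncn ((1 - eps) * k%:R),
      all (fun S => S != finset.set0) Ss,
      pairwise (fun S S' : {set V} => [disjoint S & S']) Ss
    & all (fun S => expansion H S <= bound) Ss].

Definition cheeger_bound (k : nat) (eps xi : R) : R :=
  k%:R ^+ 2 / eps `^ (3 / 2) * ln (k%:R / eps) * ln (ln (k%:R / eps)) *
  Num.sqrt (ln (edge_rank H)%:R) * Num.sqrt xi.

End Guarantee.

(* Main.v *)
Require Import Defs.
From HB Require Import structures.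
From mathcomp Require Import all_boot all_order all_algebra.
From mathcomp Require Import all_classical all_reals.
From mathcomp Require Import exp.
From mathcomp Require Import ring lra zify.

Set Implicit Arguments.
Unset Strict Implicit.
Unset Printing Implicit Defensive.

Import Order.TTheory GRing.Theory Num.Theory.
Local Open Scope ring_scope.

(** Part (a). Map each vertex [v] to [F v = (f_1 v, ..., f_k v)] in R^k and project
    radially to the unit sphere. Orthonormality makes the embedding isotropic, so
    that a set of vertices of small angular diameter has [w |F|^2]-mass at most
    [1 + O(eps)]; cut the sphere by a grid of side [sqrt (eps / k) / 3], shifted so
    that only an [eps / 4]-fraction of the mass lies within [gap / 2] of a wall,
    where [gap ~ (eps / k)^(3/2)]; averaging over O(k / eps) shifts shows that such
    a shift exists. Tapering [|F|] to 0 at the walls gives a function [height] which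
    varies by at most O(1 / gap) |F u - F v| between vertices, even after being
    restricted to a union of cells. As the cells have mass at most [1 + O(eps)] and
    the total is at least [(1 - eps / 4) k], they can be packed in
    [floor ((1 - eps) k)] groups of mass at least [1/2], and the best sweep cut of
    [height] in each group has expansion
    [O (sqrt (k xi) / gap) = O (k^2 / eps^(3/2) sqrt xi)]. The logarithmic
    factors of the statement are bounded below as soon as one set is requested and
    some hyperedge has two vertices. This algorithm is deterministic, and all its
    steps are closed formulas built from the input by arithmetic operations,
    comparisons, and sums and maxima over ranges of polynomial size.

    Part (b). On the span of the indicators of the [S i] the discrepancy is at most
    twice the largest expansion, since [(a - b)^2 <= 2 a^2 + 2 b^2]. *)

(** * Program logic with time bounds for the machine *)

Section Execution.
Variable R : realType.
Implicit Types (s : store R) (p q : cmd) (Q : store R -> Prop).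

(** Quantifying over the rest [K] of the stack makes runs composable. The tape [w] comes back
    unchanged, so these are runs that flip no coin and have the same outcome on all tapes. *)
Definition exec p s (T : nat) Q : Prop :=
  exists n s', [/\ (n <= T)%N, Q s' &
    forall K w, iter n (@step R) (Config (p :: K) s w) = Config K s' w].

Lemma exec_weaken p s T T' Q Q' : (T <= T')%N -> (forall s', Q s' -> Q' s') ->
  exec p s T Q -> exec p s T' Q'.
Proof.
by move=> le QQ [n [s' [ln /QQ q r]]]; exists n, s'; split; rewrite ?(leq_trans ln).
Qed.

Lemma exec_le T p s T' Q : (T <= T')%N -> exec p s T Q -> exec p s T' Q.
Proof. by move=> le; apply: exec_weaken. Qed.

Lemma exec_step p s s' Q :
  (forall K w, step (Config (p :: K) s w) = Config K s' w) ->
  Q s' -> exec p s 1 Q.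
Proof. by move=> r q; exists 1%N, s'; split. Qed.

Lemma exec_nset a i j e s Q :
  Q (Store (update (nmem s) a (neval s i) (neval s j) (neval s e)) (rmem s)) ->
  exec (NSet a i j e) s 1 Q.
Proof. exact: exec_step. Qed.

Lemma exec_rset a i j e s Q :
  Q (Store (nmem s) (update (rmem s) a (neval s i) (neval s j) (reval s e))) ->
  exec (RSet a i j e) s 1 Q.
Proof. exact: exec_step. Qed.

Lemma exec_skip s Q : Q s -> exec Skip s 1 Q.
Proof. exact: exec_step. Qed.

Lemma exec_seq p q s T1 T2 Q :
  exec p s T1 (fun s' => exec q s' T2 Q) -> exec (Seq p q) s (T1 + T2).+1 Q.
Proof.
move=> [n [s1 [ln [m [s2 [lm q2 r2]]] r1]]]; exists (m + n).+1, s2; split=> //.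
  by rewrite ltnS addnC leq_add.
by move=> K w; rewrite iterSr iterD /= r1 r2.
Qed.

Lemma exec_if b p q s T Q :
  exec (if beval s b then p else q) s T Q -> exec (If b p q) s T.+1 Q.
Proof.
by move=> [n [s1 [ln q1 r1]]]; exists n.+1, s1; split=> // K w; rewrite iterSr /= r1.
Qed.

(** The invariant is indexed by the number of completed iterations. Each iteration costs one test
    besides its body, and the final failing test costs one more step; the induction is on the number
    of iterations left. *)
Lemma exec_while b p T N (I : nat -> store R -> Prop) s :
  I 0 s ->
  (forall i s, (i < N)%N -> I i s -> beval s b /\ exec p s T (I i.+1)) ->
  (forall s, I N s -> ~~ beval s b) ->
  exec (While b p) s (N * T.+1).+1 (I N).
Proof.
move=> I0 IS IN.
suff H i s1 : (i <= N)%N -> I (N - i)%N s1 -> exec (While b p) s1 (i * T.+1).+1 (I N).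
  by apply: (H N s (leqnn N)); rewrite subnn.
elim: i s1 => [|i IH] s1.
  rewrite subn0 => _ I1; apply: (exec_step _ I1) => K w /=.
  by rewrite (negbTE (IN _ I1)).
move=> ltiN I1; have ltN : (N - i.+1 < N)%N by rewrite ltn_subrL (leq_trans _ ltiN).
have [bT [n [s2 [ln I2 r]]]] := IS _ _ ltN I1.
have [m [s3 [lm I3 r']]] : exec (While b p) s2 (i * T.+1).+1 (I N).
  by apply: (IH _ (ltnW ltiN)); rewrite -subnSK.
exists (m + n).+1, s3; split=> //.
  by rewrite ltnS mulSn addnC (leq_trans (leq_add ln lm)) // addnS addSn.
by move=> K w; rewrite iterSr iterD /= bT r r'.
Qed.

(** A configuration with an empty stack is a fixed point of [step], so the result can be read at any
    time past the bound. *)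
Lemma exec_run p s T Q t w : exec p s T Q -> (T <= t)%N ->
  halted (run p s t w) /\ Q (cur_store (run p s t w)).
Proof.
move=> [n [s' [ln q r]]] lt; rewrite /run -(subnK (leq_trans ln lt)) iterD r.
by have -> : forall m, iter m (@step R) (Config [::] s' w) = Config [::] s' w
  by elim=> //= m ->.
Qed.

End Execution.

(** * Expressions with iterated sums and maxima *)

(** [RgK c] has [(c + 1) * k] indices, [k] being the number of vectors; the walls of the grid and
    the digits of its shift need such multiples. *)
Inductive range := RgV | RgE | RgK of nat.

(* [EBig false] is an iterated sum, [EBig true] an iterated maximum starting at 0. *)
Inductive expr :=
| ENat of nat
| EVar of nat
| EOrder
| EDim
| EWeight of nat
| ECoord of nat & nat
| EInc of nat & nat
| EEps
| EAdd of expr & expr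
| ESub of expr & expr
| EMul of expr & expr
| EDiv of expr & expr
| ESqrt of expr
| EIf of expr & expr & expr & expr
| EBig of bool & nat & range & expr.

Definition set_var (env : nat -> nat) x i : nat -> nat :=
  fun y => if y == x then i else env y.

(** Scratch cells avoid the input arrays: integer array 2 holds the variables, and real array 3 is
    an evaluation stack indexed by depth. *)
Definition nval (x : nat) := NGet 2 (NConst x) (NConst 0).
Definition nassign (x : nat) e := NSet 2 (NConst x) (NConst 0) e.
Definition rval (t : nat) := RGet 3 (NConst t) (NConst 0).
Definition rassign (t : nat) e := RSet 3 (NConst t) (NConst 0) e.
Definition size_cell (j : nat) := NGet 0 (NConst 0) (NConst j).

Definition range_nexp rg : nexp :=
  match rg with
  | RgV => size_cell 0
  | RgE => size_cell 1
  | RgK c => iter c (NAdd (size_cell 2)) (size_cell 2)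
  end.

Definition fold_step (m : bool) t : cmd :=
  if m then If (BRealLt (rval t) (rval t.+1)) (rassign t (rval t.+1)) Skip
  else Seq (rassign t (RAdd (rval t) (rval t.+1))) Skip.

Definition binary t (op : rexp -> rexp -> rexp) (c1 c2 : cmd) : cmd :=
  Seq c1 (Seq c2 (rassign t (op (rval t) (rval t.+1)))).

(* The value is returned in the real cell (3, t, 0). A loop saves the value of
   its variable in the cell (4, t, 0), so that variables may be shadowed. *)
Fixpoint compile (t : nat) (e : expr) : cmd :=
  match e with
  | ENat c => rassign t (ROfNat (NConst c))
  | EVar x => rassign t (ROfNat (nval x))
  | EOrder => rassign t (ROfNat (size_cell 0))
  | EDim => rassign t (ROfNat (size_cell 2))
  | EWeight x => rassign t (RGet 0 (NConst 0) (nval x))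
  | ECoord x y => rassign t (RGet 1 (nval x) (nval y))
  | EInc x y => rassign t (ROfNat (NGet 1 (nval x) (nval y)))
  | EEps => rassign t (RGet 2 (NConst 0) (NConst 0))
  | EAdd e1 e2 => binary t RAdd (compile t e1) (compile t.+1 e2)
  | ESub e1 e2 => binary t RSub (compile t e1) (compile t.+1 e2)
  | EMul e1 e2 => binary t RMul (compile t e1) (compile t.+1 e2)
  | EDiv e1 e2 => binary t RDiv (compile t e1) (compile t.+1 e2)
  | ESqrt e1 => Seq (compile t e1) (rassign t (RSqrt (rval t)))
  | EIf e1 e2 e3 e4 =>
      Seq (compile t e1) (Seq (compile t.+1 e2)
        (If (BRealLt (rval t) (rval t.+1)) (compile t e3) (compile t e4)))
  | EBig m x rg e1 =>
      Seq (NSet 4 (NConst t) (NConst 0) (nval x))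
     (Seq (nassign x (NConst 0))
     (Seq (rassign t (ROfNat (NConst 0)))
     (Seq (While (BNatLt (nval x) (range_nexp rg))
             (Seq (compile t.+1 e1)
             (Seq (fold_step m t)
                  (nassign x (NAdd (nval x) (NConst 1))))))
          (nassign x (NGet 4 (NConst t) (NConst 0))))))
  end.

(** [N] stands for a common bound on the numbers of vertices, hyperedges and vectors. A conditional
    is charged for both branches. *)
Fixpoint cost (N : nat) (e : expr) : nat :=
  match e with
  | EAdd e1 e2 | ESub e1 e2 | EMul e1 e2 | EDiv e1 e2 =>
      (cost N e1 + cost N e2 + 3)%N
  | ESqrt e1 => (cost N e1 + 2)%N
  | EIf e1 e2 e3 e4 => (cost N e1 + cost N e2 + cost N e3 + cost N e4 + 3)%N
  | EBig _ _ rg e1 =>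
      ((if rg is RgK c then c.+1 else 1) * N * (cost N e1 + 7) + 9)%N
  | _ => 1%N
  end.

(** The form [a * N ^ d] is that of the time bound in the theorem. Asking for [0 < N] makes powers
    of [N] monotone in the exponent, as sums require. *)
Definition polynomial (f : nat -> nat) :=
  exists a d, forall N, (0 < N)%N -> (f N <= a * N ^ d)%N.

Lemma polynomial_const c : polynomial (fun=> c).
Proof. by exists c, 0%N => N _; rewrite muln1. Qed.

Lemma polynomial_id : polynomial id.
Proof. by exists 1%N, 1%N => N _; rewrite mul1n. Qed.

Lemma polynomial_add f g :
  polynomial f -> polynomial g -> polynomial (fun N => f N + g N)%N.
Proof.
move=> [a [d fP]] [b [e gP]]; exists (a + b)%N, (d + e)%N => N N0.
rewrite mulnDl leq_add //.
  by rewrite (leq_trans (fP N N0)) // leq_mul2l leq_pexp2l ?leq_addr ?orbT.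
by rewrite (leq_trans (gP N N0)) // leq_mul2l leq_pexp2l ?leq_addl ?orbT.
Qed.

Lemma polynomial_mul f g :
  polynomial f -> polynomial g -> polynomial (fun N => f N * g N)%N.
Proof.
move=> [a [d fP]] [b [e gP]]; exists (a * b)%N, (d + e)%N => N N0.
by rewrite expnD mulnACA leq_mul ?fP ?gP.
Qed.

Ltac polynomial :=
  repeat first [exact: polynomial_const | exact: polynomial_id | assumption
               | apply: polynomial_add | apply: polynomial_mul].

Lemma polynomial_cost e : polynomial (cost^~ e).
Proof. by elim: e => *; polynomial. Qed.

(** On all of [R], 0 is not neutral for [Num.max]; the last term is split off by comparing upper
    bounds. *)
Lemma bigmax_ord_recr (R : realType) n (F : nat -> R) :
  \big[Num.max/0]_(i < n.+1) F i = Num.max (\big[Num.max/0]_(i < n) F i) (F n).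
Proof.
apply/le_anti/andP; split.
  apply/bigmax_leP; split=> [|i _]; first by rewrite le_max bigmax_ge_id.
  rewrite le_max; have [lin|lni] := ltnP i n.
    by rewrite (le_bigmax _ (fun i : 'I_n => F i) (Ordinal lin)).
  have -> : i = n :> nat by apply/eqP; rewrite eqn_leq -ltnS ltn_ord.
  by rewrite lexx orbT.
rewrite ge_max (le_bigmax _ (fun i : 'I_n.+1 => F i) ord_max) andbT.
by rewrite (le_bigmax_ord xpredT).
Qed.

(** * Denotation of expressions and correctness of their compilation *)

Section Evaluation.
Variables (R : realType) (s0 : store R).
Implicit Types (s : store R) (env : nat -> nat).

Definition range_size rg : nat :=
  match rg with
  | RgV => nmem s0 0 0 0
  | RgE => nmem s0 0 0 1
  | RgK c => iter c (addn (nmem s0 0 0 2)) (nmem s0 0 0 2)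
  end.

Fixpoint eval env (e : expr) : R :=
  match e with
  | ENat c => c%:R
  | EVar x => (env x)%:R
  | EOrder => (nmem s0 0 0 0)%:R
  | EDim => (nmem s0 0 0 2)%:R
  | EWeight x => rmem s0 0 0 (env x)
  | ECoord x y => rmem s0 1 (env x) (env y)
  | EInc x y => (nmem s0 1 (env x) (env y))%:R
  | EEps => rmem s0 2 0 0
  | EAdd e1 e2 => eval env e1 + eval env e2
  | ESub e1 e2 => eval env e1 - eval env e2
  | EMul e1 e2 => eval env e1 * eval env e2
  | EDiv e1 e2 => eval env e1 / eval env e2
  | ESqrt e1 => Num.sqrt (eval env e1)
  | EIf e1 e2 e3 e4 =>
      if eval env e1 < eval env e2 then eval env e3 else eval env e4
  | EBig m x rg e1 =>
      if m then \big[Num.max/0]_(i < range_size rg) eval (set_var env x i) e1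
      else \sum_(i < range_size rg) eval (set_var env x i) e1
  end.

Record models s env : Prop := Models {
  models_nmem : forall a i j, (a < 2)%N -> nmem s a i j = nmem s0 a i j;
  models_rmem : forall a i j, (a < 3)%N -> rmem s a i j = rmem s0 a i j;
  models_var : forall x, nmem s 2 x 0 = env x }.

(** What code compiled at depth [t] may disturb: the saved variables and the evaluation stack, from
    row [t] on. Variables and the pending values of outer expressions survive. *)
Definition keeps t s s' : Prop :=
  (forall a i j, (a != 4)%N || (i < t)%N -> nmem s' a i j = nmem s a i j) /\
  (forall a i j, (a != 3)%N || (i < t)%N -> rmem s' a i j = rmem s a i j).

Lemma keeps_trans t s1 s2 s3 : keeps t s1 s2 -> keeps t s2 s3 -> keeps t s1 s3.
Proof.
by move=> [n12 r12] [n23 r23]; split=> a i j ok; rewrite ?n23 ?r23 ?n12 ?r12.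
Qed.

Lemma keepsW t s s' : keeps t.+1 s s' -> keeps t s s'.
Proof.
by case=> n r; split=> a i j /orP[ok|ok]; rewrite (n, r) ?ok // (leq_trans ok (leqnSn t)) orbT.
Qed.

Lemma keeps_models t s s' env : keeps t s s' -> models s env -> models s' env.
Proof.
move=> [n r] [mn mr mv]; split=> [a i j la|a i j la|x].
- by rewrite n ?mn //; case: a la => [|[|[|[|[|]]]]].
- by rewrite r ?mr //; case: a la => [|[|[|[|[|]]]]].
- by rewrite n.
Qed.

Lemma neval_range s env rg : models s env -> neval s (range_nexp rg) = range_size rg.
Proof.
case=> mn _ _; case: rg => [||c] /=; rewrite ?mn //.
by elim: c => [|c IH] /=; rewrite ?mn ?IH.
Qed.

Lemma keeps_rset t s x :
  keeps t s (Store (nmem s) (update (rmem s) 3 t 0 x)).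
Proof.
split=> // a i j ok /=; rewrite /update.
by case: ifP => // /and3P[/eqP ea /eqP ei _]; move: ok; rewrite ea ei ltnn.
Qed.

Definition computes (c : cmd) s t T (x : R) : Prop :=
  exec c s T (fun s' => rmem s' 3 t 0 = x /\ keeps t s s').

Lemma computes_set s t r x : reval s r = x ->
  computes (rassign t r) s t 1 x.
Proof.
move=> rx; apply: exec_rset => /=; split; last exact: keeps_rset.
by rewrite /update !eqxx.
Qed.

Lemma computes_binary t op (f : R -> R -> R) c1 c2 s T1 T2 x y :
  (forall s' r1 r2, reval s' (op r1 r2) = f (reval s' r1) (reval s' r2)) ->
  computes c1 s t T1 x ->
  (forall s', keeps t s s' -> computes c2 s' t.+1 T2 y) ->
  computes (binary t op c1 c2) s t (T1 + T2 + 3) (f x y).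
Proof.
move=> opE c1P c2P; rewrite /computes /binary; apply: (@exec_le _ (T1 + (T2 + 1).+1).+1).
  by rewrite addn1 addnS addn3 addnS.
apply: exec_seq; apply: exec_weaken c1P => // s1 [s1x k1].
apply: exec_seq; apply: exec_weaken (c2P _ k1) => // s2 [s2y k2].
apply: exec_weaken (@computes_set s2 t _ (f x y) _) => //.
  move=> s3 [s3x k3]; split=> //.
  by apply: keeps_trans k1 _; apply: keeps_trans k3; exact: keepsW.
by rewrite opE /=; case: k2 => _ r2; rewrite s2y r2 ?s1x //= ltnSn orbT.
Qed.

Lemma exec_fold_step m t s x y Q :
  rmem s 3 t 0 = x -> rmem s 3 t.+1 0 = y ->
  (forall s', rmem s' 3 t 0 = (if m then Num.max x y else x + y) ->
     keeps t s s' -> nmem s' = nmem s -> Q s') ->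
  exec (fold_step m t) s 3 Q.
Proof.
move=> sx sy QP; case: m QP => QP /=.
  apply: (@exec_le _ 2) => //; apply: exec_if => /=.
  rewrite sx sy; case: ltP => xy.
    apply: exec_rset; apply: QP => //=; last exact: keeps_rset.
    by rewrite /update !eqxx /= sy max_r // ltW.
  by apply: exec_skip; apply: QP; rewrite ?max_l.
apply: (@exec_le _ (1 + 1).+1) => //; apply: exec_seq.
apply: exec_rset; apply: exec_skip; apply: QP => //=; last exact: keeps_rset.
by rewrite /update !eqxx /= sx sy.
Qed.

Lemma set_var_eq env x i : set_var env x i x = i.
Proof. by rewrite /set_var eqxx. Qed.

Lemma set_var_neq env x i y : y != x -> set_var env x i y = env y.
Proof. by rewrite /set_var => /negbTE->. Qed.

Variable N : nat.
Hypotheses (N_order : (nmem s0 0 0 0 <= N)%N) (N_edges : (nmem s0 0 0 1 <= N)%N)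
  (N_dim : (nmem s0 0 0 2 <= N)%N).

Lemma range_size_le rg : (range_size rg <= (if rg is RgK c then c.+1 else 1) * N)%N.
Proof.
case: rg => [||c] /=; rewrite ?mul1n //.
by elim: c => [|c IH] /=; rewrite ?mul1n // mulSn leq_add.
Qed.

(** The weakening of [keeps] that holds inside a loop on the variable [x], whose cell is being
    modified. *)
Definition keeps_but x t s s' : Prop :=
  (forall a i j, ((a != 4)%N || (i < t)%N) && ~~ [&& a == 2, i == x & j == 0]%N ->
    nmem s' a i j = nmem s a i j) /\
  (forall a i j, (a != 3)%N || (i < t)%N -> rmem s' a i j = rmem s a i j).

Lemma compile_correct e t s env : models s env ->
  computes (compile t e) s t (cost N e) (eval env e).
Proof.
elim: e t s env => /= [c|x||| x|x y|x y||e1 IH1 e2 IH2|e1 IH1 e2 IH2|e1 IH1 e2 IH2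
  |e1 IH1 e2 IH2|e1 IH1|e1 IH1 e2 IH2 e3 IH3 e4 IH4|m x rg e IH] t s env ms;
  have [mn mr mv] := ms;
  try by [apply: computes_set => /=; rewrite ?mv ?mn ?mr].
- apply: (@computes_binary _ RAdd (fun x y => x + y)) => //; first exact: IH1.
  by move=> s' k; apply: IH2; exact: keeps_models k ms.
- apply: (@computes_binary _ RSub (fun x y => x - y)) => //; first exact: IH1.
  by move=> s' k; apply: IH2; exact: keeps_models k ms.
- apply: (@computes_binary _ RMul (fun x y => x * y)) => //; first exact: IH1.
  by move=> s' k; apply: IH2; exact: keeps_models k ms.
- apply: (@computes_binary _ RDiv (fun x y => x / y)) => //; first exact: IH1.
  by move=> s' k; apply: IH2; exact: keeps_models k ms.
- apply: (@exec_le _ (cost N e1 + 1).+1); first by rewrite addn1 addn2.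
  apply: exec_seq; apply: exec_weaken (IH1 t s env ms) => // s1 [s1x k1].
  apply: exec_weaken (@computes_set s1 t _ (Num.sqrt (eval env e1)) _) => //=.
    by move=> s' [-> k]; split=> //; exact: keeps_trans k.
  by rewrite s1x.
- apply: (@exec_le _ (cost N e1 + (cost N e2 + (cost N e3 + cost N e4).+1).+1).+1).
    by rewrite !addnS !addnA addn0.
  apply: exec_seq; apply: exec_weaken (IH1 t s env ms) => // s1 [s1x k1].
  apply: exec_seq; apply: exec_weaken (IH2 t.+1 s1 env (keeps_models k1 ms)) => // s2 [s2y k2].
  have k02 : keeps t s s2 by apply: keeps_trans k1 _; exact: keepsW.
  have m2 := keeps_models k02 ms.
  apply: exec_if => /=; rewrite s2y (proj2 k2) ?ltnSn ?orbT // s1x.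
  case: ltP => _.
    apply: exec_weaken (IH3 t s2 env m2); first exact: leq_addr.
    by move=> s3 [-> k3]; split=> //; exact: keeps_trans k3.
  apply: exec_weaken (IH4 t s2 env m2); first exact: leq_addl.
  by move=> s3 [-> k3]; split=> //; exact: keeps_trans k3.
(* The remaining case is that of a loop; [S i] is the value accumulated after [i] iterations. *)
pose G i := eval (set_var env x i) e.
pose S i : R := if m then \big[Num.max/0]_(j < i) G j else \sum_(j < i) G j.
have SS i : S i.+1 = if m then Num.max (S i) (G i) else S i + G i.
  by rewrite /S; case: (m) => /=; rewrite (bigmax_ord_recr, big_ord_recr).
(* The body runs at depth [t.+1], so it respects the accumulator and the saved value of [x], which
   both sit in row [t]. *)
pose I i s' := [/\ models s' (set_var env x i), keeps_but x t s s',
  nmem s' 4 t 0 = env x & rmem s' 3 t 0 = S i].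
rewrite -[X in computes _ _ _ _ X]/(S (range_size rg)).
apply: (@exec_le _ (1 + (1 + (1 + ((range_size rg * (cost N e + (3 + 1).+1).+1.+1).+1
   + 1).+1).+1).+1).+1).
  by rewrite !add1n !addn1 !addnS !addn0 !ltnS leq_mul // range_size_le.
apply: exec_seq; apply: exec_nset => /=.
apply: exec_seq; apply: exec_nset => /=.
apply: exec_seq; apply: exec_rset => /=.
apply: exec_seq; apply: exec_weaken (@exec_while _ _ _ _ (range_size rg) I _ _ _ _) => //.
(* Restoring [x] from its saved value turns [keeps_but] back into [keeps]. *)
- move=> s' [ms' [kn kr] s4 s3]; apply: exec_nset => /=; split=> //; split=> // a i j ok /=.
  rewrite /update s4; case: ifP => [/and3P[/eqP-> /eqP-> /eqP->]|ne].
    by rewrite mv.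
  by rewrite kn // ok ne.
- split; rewrite /= ?/update ?eqxx //=.
  + rewrite mv; split=> [a i j la|a i j la|y] /=.
    * rewrite /= /update; case: ifP => [/and3P[/eqP ea _ _]|_]; first by rewrite ea in la.
      by case: ifP => [/and3P[/eqP ea _ _]|_]; [rewrite ea in la | exact: mn].
    * by rewrite /= /update; case: ifP => [/and3P[/eqP ea _ _]|_]; [rewrite ea in la | exact: mr].
    * by rewrite /update /set_var /= eqxx andbT mv.
  + split=> a i j; rewrite /= /update.
      case/andP=> ok ne; rewrite (negbTE ne).
      by case: ifP => // /and3P[/eqP ea /eqP ei _]; move: ok; rewrite ea ei ltnn.
    by case: ifP => // /and3P[/eqP ea /eqP ei _]; rewrite ea ei ltnn.
  + by rewrite /S; case: (m) => /=; rewrite big_ord0.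
- move=> i s' lti [ms' [kn kr] s4 s3]; split.
    by rewrite /= (neval_range rg ms') (models_var ms') set_var_eq.
  apply: exec_seq; apply: exec_weaken (IH t.+1 s' _ ms') => // s1 [s1x k1].
  apply: exec_seq; apply: (exec_fold_step (x := S i) _ s1x).
    by rewrite (proj2 k1) ?ltnSn ?orbT.
  move=> s2 s2x k2 n2; have k : keeps t s' s2 by apply: keeps_trans k2; exact: keepsW.
  have m2 := keeps_models k ms'.
  apply: exec_nset => /=; split=> //.
  + have [mn2 mr2 mv2] := m2.
    split=> [a b j la|a b j la|y] /=.
    * by rewrite /update; case: ifP => [/and3P[/eqP ea _ _]|_]; [rewrite ea in la | exact: mn2].
    * exact: mr2.
    * by rewrite /update /set_var /= eqxx andbT !mv2 set_var_eq addn1 /set_var; case: eqP.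
  + split=> a b j /=.
      rewrite /update => /andP[ok ne]; rewrite (negbTE ne) (proj1 k) // kn // ok //.
    by move=> ok; rewrite (proj2 k) // kr.
  + by rewrite /= /update /= n2 (proj1 k1) ?ltnSn ?orbT.
  + by rewrite /= s2x SS.
- by move=> s' [ms' _ _ _]; rewrite /= (neval_range rg ms') (models_var ms') set_var_eq ltnn.
Qed.
End Evaluation.

(** * The program *)

Definition for_loop x rg body : cmd :=
  Seq (nassign x (NConst 0))
      (While (BNatLt (nval x) (range_nexp rg))
             (Seq body (nassign x (NAdd (nval x) (NConst 1))))).

(* The indicators of the sets are first stored in array 3, because the
   incidence matrix is still needed. *)
Definition program (member : expr) : cmd :=
  Seq (for_loop 0 (RgK 0) (for_loop 1 RgV
        (Seq (compile 0 member)
             (If (BRealLt (ROfNat (NConst 0)) (rval 0))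
                 (NSet 3 (nval 0) (nval 1) (NConst 1)) Skip))))
 (Seq (for_loop 0 (RgK 0) (for_loop 1 RgV
        (NSet 1 (nval 0) (nval 1) (NGet 3 (nval 0) (nval 1)))))
 (Seq (NSet 0 (NConst 0) (NConst 0) (NConst 0))
      (for_loop 0 (RgK 0)
        (If (BNot (BRealLt
               (RMul (RSub (ROfNat (NConst 1)) (RGet 2 (NConst 0) (NConst 0)))
                     (ROfNat (size_cell 2)))
               (RAdd (ROfNat (nval 0)) (ROfNat (NConst 1)))))
            (NSet 0 (NConst 0) (NConst 0) (NAdd (nval 0) (NConst 1))) Skip)))).

Definition program_cost member N : nat :=
  ((N * (N * (cost N member + 6) + 6) + 3) + (N * (N * 4 + 6) + 3) + (N * 5 + 3) + 4)%N.

Lemma polynomial_program_cost member : polynomial (program_cost member).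
Proof.
have ? := polynomial_cost member.
by rewrite /program_cost; polynomial.
Qed.

(** * Correctness and running time of the program *)

Section ProgramCorrectness.
Variables (R : realType) (s0 : store R).
Implicit Types (s : store R).

Definition assign s x i := Store (update (nmem s) 2 x 0 i) (rmem s).

Lemma exec_for x rg body T N s (I : nat -> store R -> Prop) :
  (forall i s', I i s' -> nmem s' 2 x 0 = i /\ neval s' (range_nexp rg) = N) ->
  I 0%N (assign s x 0) ->
  (forall i s', (i < N)%N -> I i s' ->
     exec body s' T (fun s2 => nmem s2 2 x 0 = i /\ I i.+1 (assign s2 x i.+1))) ->
  exec (for_loop x rg body) s (N * (T + 3) + 3) (I N).
Proof.
move=> IP I0 IS; apply: (@exec_le _ (1 + (N * (T + 1).+1.+1).+1).+1).
  by rewrite !addnS !addn0.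
apply: exec_seq; apply: exec_nset => /=; apply: exec_while => //.
  move=> i s' lti Ii; have [xi Ne] := IP _ _ Ii; split; first by rewrite /= xi Ne.
  apply: exec_seq; apply: exec_weaken (IS _ _ lti Ii) => // s2 [x2 I2].
  by apply: exec_nset => /=; rewrite x2 addn1.
by move=> s' Ii; have [xi Ne] := IP _ _ Ii; rewrite /= xi Ne ltnn.
Qed.

Let n := nmem s0 0 0 0.
Let k := nmem s0 0 0 2.
Variables (N : nat) (member : expr) (P : nat -> nat -> bool).
Hypotheses (N_order : (nmem s0 0 0 0 <= N)%N) (N_edges : (nmem s0 0 0 1 <= N)%N)
  (N_dim : (nmem s0 0 0 2 <= N)%N).
Hypothesis memberE : forall env, (env 0 < k)%N -> (env 1 < n)%N ->
  eval s0 env member = (P (env 0%N) (env 1%N))%:R.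
Hypothesis scratch0 : forall i j, nmem s0 3 i j = 0%N.

(* Pairs of indices preceding (i, j) in the order of the nested loops. *)
Definition before i j i' j' := (j' < n)%N && ((i' < i)%N || ((i' == i) && (j' < j)%N)).

Lemma before_row i j i' : before i n i' j = before i.+1 0 i' j.
Proof.
rewrite /before; case: (j < n)%N; rewrite //= andbT ltn0 andbF orbF.
by rewrite [in RHS]ltnS (leq_eqVlt i') orbC.
Qed.

Lemma before_next i j i' j' : (j < n)%N ->
  before i j.+1 i' j' = ((i' == i) && (j' == j)) || before i j i' j'.
Proof.
move=> jn; rewrite /before [(j' < j.+1)%N]ltnS (leq_eqVlt j').
case: (eqVneq j' j) => [->|_]; rewrite ?jn ?andbF ?andbT //=.
by case: (i' == i); rewrite ?orbT ?orbF.
Qed.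

(** The environment is read off [s] itself, so only the input arrays are constrained, not the
    variables. *)
Definition kept s := models s0 s (fun x => nmem s 2 x 0).

Lemma kept_assign s x i : kept s -> kept (assign s x i).
Proof.
case=> mn mr _; split=> // a b j la; rewrite /= /update.
by case: ifP => [/and3P[/eqP ea _ _]|_]; [rewrite ea in la | exact: mn].
Qed.

Lemma keeps_kept t s s' : keeps t s s' -> kept s -> kept s'.
Proof.
move=> ks /(keeps_models ks)[mn mr _]; split=> // x; by [].
Qed.

Lemma var_assign s x y i : nmem (assign s x i) 2 y 0 = if y == x then i else nmem s 2 y 0.
Proof. by rewrite /= /update /= eqxx andbT. Qed.

Lemma array_assign s x i a j l : a != 2%N -> nmem (assign s x i) a j l = nmem s a j l.
Proof. by move=> /negbTE; rewrite /= /update => ->. Qed.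

(** Two nested loops with one invariant: [J i j] describes the state before the cell [(i, j)] is
    treated, the end of a row counts as the start of the next, and [J] is insensitive to the
    variables. *)
Lemma exec_grid body T s (J : nat -> nat -> store R -> Prop) :
  (forall i j s', J i j s' ->
     nmem s' 0 0 0 = n /\ nmem s' 0 0 2 = k) ->
  (forall i j x v s', J i j s' -> J i j (assign s' x v)) ->
  (forall i s', J i n s' -> J i.+1 0%N s') ->
  (forall i j s', (i < k)%N -> (j < n)%N -> J i j s' ->
     nmem s' 2 0 0 = i -> nmem s' 2 1 0 = j ->
     exec body s' T (fun s2 =>
       [/\ nmem s2 2 0 0 = i, nmem s2 2 1 0 = j & J i j.+1 s2])) ->
  J 0%N 0%N s ->
  exec (for_loop 0 (RgK 0) (for_loop 1 RgV body)) s
    (N * (N * (T + 3) + 6) + 3) (J k 0%N).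
Proof.
move=> Jsize Jassign Jrow Jbody J0.
apply: (@exec_le _ (k * (n * (T + 3) + 3 + 3) + 3)).
  by rewrite leq_add2r leq_mul // -addnA leq_add2r leq_mul.
pose I i s' := nmem s' 2 0 0 = i /\ J i 0%N s'.
apply: exec_weaken (@exec_for 0 (RgK 0) _ _ k s I _ _ _) => //.
- by move=> s' [].
- by move=> i s' [-> /Jsize[_ sk]].
- by split; [rewrite var_assign | exact: Jassign].
move=> i s1 lik [e1 J1].
pose I1 j s' := [/\ nmem s' 2 0 0 = i, nmem s' 2 1 0 = j & J i j s'].
apply: exec_weaken (@exec_for 1 RgV _ T n s1 I1 _ _ _) => //.
- move=> s' [e0 _ Jn]; split=> //; split; first by rewrite var_assign.
  exact/Jassign/Jrow.
- by move=> j s' [_ -> /Jsize[sn _]].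
- by split; [rewrite var_assign | rewrite var_assign | exact: Jassign].
move=> j s2 ljn [e0 ej J2].
apply: exec_weaken (Jbody i j s2 lik ljn J2 e0 ej) => // s3 [e03 ej3 J3].
by split=> //; split; rewrite ?var_assign //; exact: Jassign.
Qed.

(** Cells of array 3 are only ever set to 1, hence the requirement that they start at 0. *)
Lemma exec_mark s : kept s -> (forall i j, nmem s 3 i j = 0%N) ->
  exec (for_loop 0 (RgK 0) (for_loop 1 RgV
        (Seq (compile 0 member)
             (If (BRealLt (ROfNat (NConst 0)) (rval 0))
                 (NSet 3 (nval 0) (nval 1) (NConst 1)) Skip)))) s
    (N * (N * (cost N member + 6) + 6) + 3)
    (fun s' => kept s' /\
       forall i j, (i < k)%N -> (j < n)%N -> nmem s' 3 i j = P i j :> nat).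
Proof.
move=> ks z.
pose J i j s' := kept s' /\ forall i' j', (i' < k)%N ->
  nmem s' 3 i' j' = (before i j i' j' && P i' j') :> nat.
apply: (@exec_le _ (N * (N * ((cost N member + 2).+1 + 3) + 6) + 3)).
  by rewrite -addnS -addnA.
apply: exec_weaken (@exec_grid _ _ s J _ _ _ _ _) => //.
- by move=> s' [k' H]; split=> // i j ik jn; rewrite H // /before jn ik.
- by move=> i j s' [[mn _ _] _]; rewrite !mn.
- move=> i j x v s' [k' H]; split; first exact: kept_assign.
  by move=> i' j' ik; rewrite array_assign ?H.
- by move=> i s' [k' H]; split=> // i' j' ik; rewrite H // before_row.
- move=> i j s1 lik ljn [k1 H1] ei ej.
  apply: exec_seq.
  have := compile_correct N_order N_edges N_dim member 0 k1.
  apply: exec_weaken => // s2 [s2x ks2]; apply: exec_if => /=.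
  have k2 := keeps_kept ks2 k1; have n2 := proj1 ks2.
  have H2 i' j' : (i' < k)%N ->
      nmem s2 3 i' j' = (before i j i' j' && P i' j') :> nat.
    by move=> ik; rewrite n2 ?H1.
  have jF : before i j i j = false by rewrite /before !ltnn /= !andbF.
  rewrite s2x memberE ?ei ?ej // ltr0n; case Pij: (P i j) => /=.
    apply: exec_nset => /=. rewrite !n2 // ei ej.
    split; [by rewrite /update /= n2 | by rewrite /update /= n2 |].
    split; first by have [mn mr _] := k2; split=> // -[|[|]] b l // _; exact: mn.
    move=> i' j' ik; rewrite /= /update /= before_next //.
    case: eqP => [->|_]; case: eqP => [->|_] //=; rewrite ?Pij ?H2 //.
  apply: exec_skip; split; rewrite ?n2 //; split=> // i' j' ik.
  rewrite H2 // before_next //; case: eqP => [->|] //=; case: eqP => [->|] //=.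
  by rewrite jF Pij.
- by split=> // i' j' ik; rewrite z /before ltn0 ltn0 !andbF.
Qed.

Lemma exec_copy s : kept s ->
  (forall i j, (i < k)%N -> (j < n)%N -> nmem s 3 i j = P i j :> nat) ->
  exec (for_loop 0 (RgK 0) (for_loop 1 RgV
        (NSet 1 (nval 0) (nval 1) (NGet 3 (nval 0) (nval 1))))) s
    (N * (N * 4 + 6) + 3)
    (fun s' => [/\ nmem s' 0 0 2 = k, rmem s' = rmem s &
       forall i j, (i < k)%N -> (j < n)%N -> nmem s' 1 i j = P i j :> nat]).
Proof.
move=> ks P3.
(* Overwriting array 1 destroys the incidence matrix, so [kept] is replaced by what is still read
   afterwards: the sizes, the reals and array 3. *)
pose J i j s' := [/\ forall l, nmem s' 0 0 l = nmem s0 0 0 l, rmem s' = rmem s,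
  (forall i j, (i < k)%N -> (j < n)%N -> nmem s' 3 i j = P i j :> nat) &
  forall i' j', (i' < k)%N -> before i j i' j' -> nmem s' 1 i' j' = P i' j' :> nat].
apply: exec_weaken (@exec_grid _ 1 s J _ _ _ _ _) => //.
- move=> s' [z r _ H]; split=> // i j ik jn.
  by rewrite H // /before jn ik.
- by move=> i j s' [z _ _ _]; rewrite !z.
- by move=> i s' [z r H3 H]; split=> // i' j' ik; rewrite -before_row; exact: H.
- move=> i j s1 lik ljn [z r H3 H] ei ej.
  apply: exec_nset; rewrite /= ei ej; split=> //; split=> // i' j' ik.
  rewrite before_next //= /update /= => b; case: ifP => [/andP[/eqP-> /eqP->]|nij].
    exact: H3.
  by rewrite nij in b; exact: H.
- have [mn _ _] := ks; split=> //; first by move=> l; rewrite mn.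
  by move=> i' j' _; rewrite /before !ltn0 !andbF.
Qed.

(** The machine cannot round reals, so the floor of [(1 - eps) * k] is found by counting the [i < k]
    with [i + 1 <= (1 - eps) * k]. Since [0 <= eps], the floor is at most [k] and the count is
    complete. *)
Lemma exec_count s (eps : R) : nmem s 0 0 2 = k -> rmem s 2 0 0 = eps -> 0 <= eps ->
  (forall i j, (i < k)%N -> (j < n)%N -> nmem s 1 i j = P i j :> nat) ->
  exec (Seq (NSet 0 (NConst 0) (NConst 0) (NConst 0))
      (for_loop 0 (RgK 0)
        (If (BNot (BRealLt
               (RMul (RSub (ROfNat (NConst 1)) (RGet 2 (NConst 0) (NConst 0)))
                     (ROfNat (size_cell 2)))
               (RAdd (ROfNat (nval 0)) (ROfNat (NConst 1)))))
            (NSet 0 (NConst 0) (NConst 0) (NAdd (nval 0) (NConst 1))) Skip)))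
    s (N * 5 + 3 + 2)
    (fun s' => nmem s' 0 0 0 = Num.truncn ((1 - eps) * k%:R) /\
       forall i j, (i < k)%N -> (j < n)%N -> nmem s' 1 i j = P i j :> nat).
Proof.
move=> sk se eps0 P1; set y := (1 - eps) * k%:R.
have leyk : (Num.truncn y <= k)%N.
  rewrite truncn_le_nat (@le_lt_trans _ _ k%:R) ?ltr_nat //.
  by rewrite /y mulrBl mul1r gerBl mulr_ge0.
apply: (@exec_le _ (1 + (k * (2 + 3) + 3)).+1).
  by rewrite addn2 add1n !ltnS leq_add2r leq_mul.
apply: exec_seq; apply: exec_nset.
pose I i s' := [/\ nmem s' 2 0 0 = i, nmem s' 0 0 2 = k, rmem s' 2 0 0 = eps,
  nmem s' 0 0 0 = minn i (Num.truncn y) &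
  forall i j, (i < k)%N -> (j < n)%N -> nmem s' 1 i j = P i j :> nat].
apply: exec_weaken (@exec_for 0 (RgK 0) _ 2 k _ I _ _ _) => //.
- by move=> s' [_ _ _ -> H]; split=> //; rewrite (minn_idPr leyk).
- by move=> i s' [].
- by split=> //; rewrite min0n.
move=> i s1 lik [ei s1k s1e s1c H1]; apply: exec_if => /=.
rewrite s1e s1k ei -/y -natrD addn1 -truncn_le_nat -ltnNge.
case: ltnP => [lity|leyi].
  apply: (@exec_le _ 1) => //; apply: exec_nset; split=> //.
  split; rewrite ?var_assign //= /update /= ?ei ?addn1 ?(minn_idPl lity) //.
apply: (@exec_le _ 1) => //; apply: exec_skip; split=> //.
split; rewrite ?var_assign //= /update /= ?s1c //.
by rewrite !(minn_idPr _) // ltnW.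
Qed.

Theorem exec_program eps : rmem s0 2 0 0 = eps -> 0 <= eps ->
  exec (program member) s0 (program_cost member N)
    (fun s' => nmem s' 0 0 0 = Num.truncn ((1 - eps) * k%:R) /\
       forall i j, (i < k)%N -> (j < n)%N -> nmem s' 1 i j = P i j :> nat).
Proof.
move=> epsE eps0; rewrite /program_cost.
rewrite -!addnA; apply: (@exec_le _ ((N * (N * (cost N member + 6) + 6) + 3) +
  ((N * (N * 4 + 6) + 3) + (N * 5 + 3 + 2)).+1).+1); first by lia.
have k0 : kept s0 by [].
apply: exec_seq; apply: exec_weaken (exec_mark k0 scratch0) => // s1 [k1 H1].
apply: exec_seq; apply: exec_weaken (exec_copy k1 H1) => // s2 [s2k s2r H2].
apply: exec_count => //; rewrite s2r; have [_ mr _] := k1; by rewrite mr.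
Qed.

End ProgramCorrectness.

(** * Sweep cuts *)

Section SweepCut.
Variables (R : realType) (V : finType) (H : hypergraph R V).
Implicit Types (S e : {set V}) (G g : V -> R).

Definition oscillation G e : R :=
  \big[Num.max/0]_(u in e) \big[Num.max/0]_(v in e) (G u - G v).

Lemma oscillation_ge0 G e : 0 <= oscillation G e.
Proof. exact: bigmax_ge_id. Qed.

Lemma oscillation_ge G e u v : u \in e -> v \in e -> G u - G v <= oscillation G e.
Proof.
move=> ue ve; apply: (bigmax_sup u) => //.
exact: (le_bigmax_cond _ (fun v => G u - G v)).
Qed.

Lemma oscillation_le G e x : 0 <= x ->
  (forall u v, u \in e -> v \in e -> G u - G v <= x) -> oscillation G e <= x.
Proof. by move=> x0 le; apply: bigmax_le => // u ue; apply: bigmax_le => // v; exact: le. Qed.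

Definition cut S : R := \sum_(e in boundary H S) weight H e.

Lemma boundaryP S e : reflect
  [/\ e \in edges H, exists2 u, u \in e & u \in S & exists2 v, v \in e & v \notin S]
  (e \in boundary H S).
Proof.
rewrite inE; apply: (iffP and3P)
  => [[ee /pred0Pn[u /andP[ue uS]] /pred0Pn[v /andP[/= ve]]]|[ee [u ue uS] [v ve vS]]].
  by rewrite inE => vS; split=> //; [exists u | exists v].
split=> //.
- by apply/pred0Pn; exists u; rewrite /= ue.
- by apply/pred0Pn; exists v; rewrite /= ve inE.
Qed.

Lemma cutE S : cut S = \sum_(e in edges H) weight H e * (e \in boundary H S)%:R.
Proof.
rewrite /cut big_mkcond [RHS]big_mkcond; apply: eq_bigr => e _.
case: boundaryP => [[-> _ _]|_]; rewrite ?mulr1 // mulr0.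
by case: ifP.
Qed.

Lemma vweight_gt0 v : 0 < vweight H v.
Proof. exact: degree_gt0. Qed.

Lemma volume_gt0 S v : v \in S -> 0 < volume H S.
Proof.
move=> vS; rewrite /volume (bigD1 v) //= ltr_wpDr ?vweight_gt0 //.
by apply: sumr_ge0 => u _; exact/ltW/vweight_gt0.
Qed.

Lemma sum_vweight g :
  \sum_v vweight H v * g v = \sum_(e in edges H) weight H e * \sum_(v in e) g v.
Proof.
under eq_bigr do rewrite mulr_suml; rewrite (exchange_big_dep (mem (edges H))) /=.
  by apply: eq_bigr => e ee; rewrite mulr_sumr; apply: eq_bigl => v; rewrite ee.
by move=> v e _ /andP[].
Qed.

(* Peels off the lowest level set of [G], where [G] takes its least positive value. *)
Lemma coarea_le G theta : (forall v, 0 <= G v) ->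
  (forall z, 0 < G z ->
     theta * volume H [set v | G z <= G v]%SET <= cut [set v | G z <= G v]%SET) ->
  theta * (\sum_v vweight H v * G v) <= \sum_(e in edges H) weight H e * oscillation G e.
Proof.
have [n] := ubnP #|[set v | 0 < G v]%SET|; elim: n G => // n IH G lt G0 lev.
have [z z0|no] := pickP (fun v => 0 < G v); last first.
  rewrite big1 ?mulr0 => [|v _].
    by apply: sumr_ge0 => e ee; rewrite mulr_ge0 ?weight_ge0 ?oscillation_ge0.
  suff -> : G v = 0 by rewrite mulr0.
  by apply/le_anti; rewrite G0 andbT leNgt no.
pose z1 := [arg min_(v < z | 0 < G v) G v]%O.
have [z1_gt0 z1_min] : 0 < G z1 /\ forall v, 0 < G v -> G z1 <= G v.
  by rewrite /z1; case: arg_minP.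
set t := G z1 in z1_gt0 z1_min.
pose S := [set v | t <= G v]%SET.
pose G' v := if 0 < G v then G v - t else 0.
have inS v : (v \in S) = (0 < G v).
  by rewrite inE; apply/idP/idP => [|/z1_min //]; exact: lt_le_trans.
have G0' v : v \notin S -> G v = 0.
  by rewrite inS -leNgt => le; apply/le_anti; rewrite le G0.
have GE v : G v = G' v + t * (v \in S)%:R.
  rewrite /G'; case: (boolP (v \in S)) => vS; rewrite ?mulr1 ?mulr0.
    by rewrite -inS vS subrK.
  by rewrite -inS (negbTE vS) G0' // addr0.
have G'0 v : 0 <= G' v.
  by rewrite /G'; case: ifP => // /z1_min; rewrite subr_ge0.
have step : theta * (\sum_v vweight H v * G' v)
    <= \sum_(e in edges H) weight H e * oscillation G' e.
  apply: IH => //.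
    apply: leq_trans (proper_card _) _; last exact: lt.
    apply/properP; split.
      by apply/fintype.subsetP => v; rewrite !inE /G'; case: ifP => // _; rewrite ltxx.
    by exists z1; rewrite !inE ?z1_gt0 // /G' z1_gt0 subrr ltxx.
  (* Level sets of [G'] at positive values are level sets of [G], so the hypothesis passes to
     [G']. *)
  move=> u; rewrite {1}/G'; case: ifP; rewrite ?ltxx // => u0 ut.
  suff -> : [set v | G' u <= G' v]%SET = [set v | G u <= G v]%SET by exact: lev.
  apply/setP => v; rewrite !inE /G' u0; case: ifP => v0; first by rewrite lerD2r.
  rewrite !leNgt ut /=; apply/esym/negbTE; rewrite negbK.
  by rewrite (G0' v) ?inS ?v0 // u0.
have -> : \sum_v vweight H v * G v = \sum_v vweight H v * G' v + t * volume H S.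
  rewrite /volume mulr_sumr [X in _ = _ + X]big_mkcond -big_split /=.
  apply: eq_bigr => v _; rewrite GE mulrDr; case: (v \in S); last by rewrite mulr0 mulr0.
  by rewrite mulr1 [t * _]mulrC.
have cutS := lev _ z1_gt0; rewrite -/t -/S in cutS.
rewrite mulrDr mulrCA.
apply: le_trans (lerD step (ler_wpM2l (ltW z1_gt0) cutS)) _.
(* Edge by edge, [oscillation G] must exceed [oscillation G'] by at least [t] if the hyperedge
   crosses [S], and be no smaller otherwise. On a crossing hyperedge [G] vanishes somewhere, so its
   oscillation is its maximum there, which drops by [t]; a hyperedge inside [S] is merely
   translated. *)
rewrite cutE mulr_sumr -big_split /=; apply: ler_sum => e ee.
rewrite mulrCA -mulrDr ler_wpM2l ?weight_ge0 // -lerBrDr.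
case: boundaryP => [[_ [u0 u0e u0S] [v0 v0e v0S]]|nb]; rewrite ?mulr1 ?mulr0 ?subr0.
  have low : t <= oscillation G e.
    apply: (le_trans _ (oscillation_ge G u0e v0e)); rewrite (G0' _ v0S) subr0.
    by rewrite inE in u0S.
  apply: oscillation_le; rewrite ?subr_ge0 // => u v ue ve.
  apply: (@le_trans _ _ (G' u)); first by rewrite gerBl.
  have [uS|uS] := boolP (u \in S).
    rewrite lerBrDr; apply: (le_trans _ (oscillation_ge G ue v0e)).
    by rewrite (G0' _ v0S) subr0 GE uS mulr1.
  by rewrite /G' -inS (negbTE uS) subr_ge0.
apply: oscillation_le => [|u v ue ve]; first exact: oscillation_ge0.
have [uS|uS] := boolP (u \in S); last first.
  apply: (@le_trans _ _ 0); last exact: oscillation_ge0.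
  by rewrite {1}/G' -inS (negbTE uS) sub0r oppr_le0.
have vS : v \in S by apply: contra_notT nb => vS; split=> //; [exists u | exists v].
apply: (le_trans _ (oscillation_ge G ue ve)).
by rewrite (GE u) (GE v) uS vS opprD addrACA subrr addr0.
Qed.

(** Cheeger's argument: [coarea_le] is applied to the square of [g]. On a hyperedge
    [g u ^+ 2 - g v ^+ 2 <= 2 * D e * g u], which is at most [2 / theta * D e ^+ 2 + theta / 2 * g u
    ^+ 2] by completing a square. Summed over incidences, the last terms amount to half of the left
    side and are absorbed there. *)
Lemma sweep_cut g (D : {set V} -> R) theta : (forall v, 0 <= g v) -> 0 < theta ->
  (forall e u v, e \in edges H -> u \in e -> v \in e -> g u - g v <= D e) ->
  (forall z, 0 < g z -> theta <= expansion H [set v | g z <= g v]%SET) ->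
  theta ^+ 2 * (\sum_v vweight H v * g v ^+ 2) <=
  4 * \sum_(e in edges H) weight H e * D e ^+ 2.
Proof.
move=> g0 th0 gD sweep; set M := \sum_v _; set E := \sum_(e in _) _.
have co : theta * M <= \sum_(e in edges H) weight H e * oscillation (fun v => g v ^+ 2) e.
  apply: coarea_le => [v|z]; first exact: sqr_ge0.
  rewrite lt_neqAle eq_sym sqrf_eq0 => /andP[gz_neq0 _].
  have gz : 0 < g z by rewrite lt_neqAle eq_sym gz_neq0 g0.
  have -> : [set v | g z ^+ 2 <= g v ^+ 2]%SET = [set v | g z <= g v]%SET.
    by apply/setP => v; rewrite !inE ler_sqr ?nnegrE.
  have /volume_gt0 vol0 : z \in [set v | g z <= g v]%SET by rewrite inE.
  by have := sweep z gz; rewrite ler_pdivlMr.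
have bound : theta * M <= 2 / theta * E + theta / 2 * M.
  apply: le_trans co _; rewrite /M sum_vweight !mulr_sumr -big_split /=.
  apply: ler_sum => e ee; rewrite mulrCA (mulrCA (theta / 2)) -mulrDr.
  rewrite ler_wpM2l ?weight_ge0 //; apply: oscillation_le => [|u v ue ve].
    rewrite addr_ge0 // mulr_ge0 ?divr_ge0 ?sqr_ge0 ?sumr_ge0 ?(ltW th0) //.
    by move=> v _; exact: sqr_ge0.
  apply: (@le_trans _ _ (2 / theta * D e ^+ 2 + theta / 2 * g u ^+ 2)); last first.
    rewrite lerD2l ler_wpM2l ?divr_ge0 ?(ltW th0) // (bigD1 u) //= lerDl.
    by apply: sumr_ge0 => w _; exact: sqr_ge0.
  have [le|lt] := leP (g u) (g v).
    apply: (@le_trans _ _ 0).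
      by rewrite subr_le0 ler_sqr ?nnegrE.
    by rewrite addr_ge0 // mulr_ge0 ?divr_ge0 ?sqr_ge0 ?(ltW th0).
  have D0 := gD e u v ee ue ve.
  apply: (@le_trans _ _ (2 * (D e * g u))).
    rewrite subr_sqr [2 * _]mulrCA; apply: ler_pM => //.
    - by rewrite subr_ge0 ltW.
    - by rewrite addr_ge0.
    - by rewrite mulr_natl mulr2n lerD2l ltW.
  have -> : 2 / theta * D e ^+ 2 + theta / 2 * g u ^+ 2 =
      2 * (D e * g u) + 2 / theta * (D e - theta / 2 * g u) ^+ 2.
    by field; rewrite gt_eqF.
  by rewrite lerDl mulr_ge0 ?sqr_ge0 ?divr_ge0 ?(ltW th0).
have {}bound : theta / 2 * M <= 2 / theta * E.
  by rewrite -(lerD2r (theta / 2 * M)) -mulrDl -splitr.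
have := ler_wpM2l (ltW th0) (ler_wpM2l (ler0n R 2) bound).
have -> : theta * (2 * (theta / 2 * M)) = theta ^+ 2 * M by field.
by have -> : theta * (2 * (2 / theta * E)) = 4 * E by field; rewrite gt_eqF.
Qed.
End SweepCut.

(** * The radial projection of the spectral embedding *)

Section Embedding.
Variables (R : realType) (V : finType) (k : nat) (fs : k.-tuple (vec R V)).
Implicit Types (s : 'I_k) (u v : V).

Definition coord s v : R := (tnth fs s : vec R V) v.
Definition norm v : R := Num.sqrt (\sum_s coord s v ^+ 2).
(** A vertex embedded at the origin gets direction 0, since division by 0 yields 0. *)
Definition dir s v : R := coord s v / norm v.
Definition dist u v : R := Num.sqrt (\sum_s (coord s u - coord s v) ^+ 2).

Lemma sum_sqr_ge0 (F : 'I_k -> R) : 0 <= \sum_s F s ^+ 2.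
Proof. by apply: sumr_ge0 => s _; exact: sqr_ge0. Qed.

Lemma norm_ge0 v : 0 <= norm v. Proof. exact: sqrtr_ge0. Qed.
Lemma dist_ge0 u v : 0 <= dist u v. Proof. exact: sqrtr_ge0. Qed.

Lemma norm_sqr v : norm v ^+ 2 = \sum_s coord s v ^+ 2.
Proof. by rewrite sqr_sqrtr ?sum_sqr_ge0. Qed.

Lemma distC u v : dist u v = dist v u.
Proof. by congr Num.sqrt; apply: eq_bigr => s _; rewrite -sqrrN opprB. Qed.

Lemma sqr_le_sum (F : 'I_k -> R) s : F s ^+ 2 <= \sum_s F s ^+ 2.
Proof. by rewrite (bigD1 s) //= lerDl sumr_ge0 // => s' _; exact: sqr_ge0. Qed.

Lemma normr_le_sqrt (x y : R) : x ^+ 2 <= y -> `|x| <= Num.sqrt y.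
Proof. by move=> le; rewrite -sqrtr_sqr ler_wsqrtr. Qed.

Lemma coord_le_norm s v : `|coord s v| <= norm v.
Proof. exact/normr_le_sqrt/(sqr_le_sum (coord^~ v)). Qed.

Lemma coord_le_dist s u v : `|coord s u - coord s v| <= dist u v.
Proof. exact/normr_le_sqrt/(sqr_le_sum (fun s => coord s u - coord s v)). Qed.

Lemma norm_dir s v : norm v * dir s v = coord s v.
Proof.
rewrite /dir; have [n0|n0] := eqVneq (norm v) 0; last by rewrite mulrC divfK.
rewrite n0 mul0r; apply/esym/eqP; rewrite -normr_le0 -n0; exact: coord_le_norm.
Qed.

Lemma dir_le1 s v : `|dir s v| <= 1.
Proof.
rewrite normrM normfV (ger0_norm (norm_ge0 v)).
have [->|n0] := eqVneq (norm v) 0; first by rewrite invr0 mulr0.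
by rewrite ler_pdivrMr ?mul1r ?coord_le_norm // lt_neqAle eq_sym n0 norm_ge0.
Qed.

Lemma sum_dir_sqr v : norm v != 0 -> \sum_s dir s v ^+ 2 = 1.
Proof.
move=> n0; have : norm v ^+ 2 * (\sum_s dir s v ^+ 2) = norm v ^+ 2 * 1.
  by rewrite mulr_sumr mulr1 [RHS]norm_sqr; apply: eq_bigr => s _; rewrite -exprMn norm_dir.
by apply: mulfI; rewrite expf_neq0.
Qed.

(** Lagrange's identity: twice the difference of the two sides is a sum of squares. *)
Lemma cauchy_schwarz (F G : 'I_k -> R) :
  (\sum_s F s * G s) ^+ 2 <= (\sum_s F s ^+ 2) * (\sum_s G s ^+ 2).
Proof.
have : 0 <= \sum_s \sum_s' (F s * G s' - F s' * G s) ^+ 2.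
  by apply: sumr_ge0 => s _; exact: sum_sqr_ge0.
have -> : \sum_s \sum_s' (F s * G s' - F s' * G s) ^+ 2 =
    2 * ((\sum_s F s ^+ 2) * (\sum_s G s ^+ 2) - (\sum_s F s * G s) ^+ 2).
  transitivity (\sum_s \sum_s' (F s ^+ 2 * G s' ^+ 2 + G s ^+ 2 * F s' ^+ 2
     - 2 * ((F s * G s) * (F s' * G s')))).
    by apply: eq_bigr => s _; apply: eq_bigr => s' _; ring.
  under eq_bigr => s _ do
    rewrite big_split big_split /= -!mulr_sumr sumrN -!mulr_sumr.
  rewrite !big_split /= sumrN -!mulr_suml -!mulr_sumr -mulr_suml.
  by ring.
by rewrite pmulr_rge0 // subr_ge0.
Qed.

Lemma norm_sub_le u v : `|norm u - norm v| <= dist u v.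
Proof.
apply: normr_le_sqrt.
have -> : (norm u - norm v) ^+ 2 = norm u ^+ 2 + norm v ^+ 2 - 2 * (norm u * norm v) by ring.
have -> : \sum_s (coord s u - coord s v) ^+ 2 =
    norm u ^+ 2 + norm v ^+ 2 - 2 * \sum_s coord s u * coord s v.
  rewrite !norm_sqr mulr_sumr -big_split -sumrB /=.
  by apply: eq_bigr => s _; ring.
rewrite lerD2l lerN2 ler_pM2l //.
apply: le_trans (ler_norm _) _; rewrite -[leRHS]ger0_norm ?mulr_ge0 ?norm_ge0 //.
by rewrite -ler_sqr ?nnegrE // !real_normK ?num_real // exprMn !norm_sqr cauchy_schwarz.
Qed.

(** [norm u * (dir s u - dir s v)] is the difference of coordinates plus
    [(norm v - norm u) * dir s v]; each term is at most [dist u v]. *)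
Lemma norm_dir_sub s u v : norm u * `|dir s u - dir s v| <= 2 * dist u v.
Proof.
rewrite -[X in X * _](ger0_norm (norm_ge0 u)) -normrM.
have -> : norm u * (dir s u - dir s v) =
    (coord s u - coord s v) + (norm v - norm u) * dir s v.
  by rewrite mulrBr mulrBl !norm_dir; ring.
apply: le_trans (ler_normD _ _) _; rewrite mulr_natl mulr2n lerD ?coord_le_dist //.
rewrite normrM -[leRHS]mulr1 ler_pM ?normr_ge0 ?dir_le1 //.
by rewrite distC norm_sub_le.
Qed.

Variable H : hypergraph R V.
Hypothesis fs_orthonormal : orthonormal_family H fs.

(** Expanding the square leaves the Gram matrix of the [fs], which is the identity. *)
Lemma isotropy (x : 'I_k -> R) :
  \sum_v vweight H v * (\sum_s x s * coord s v) ^+ 2 = \sum_s x s ^+ 2.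
Proof.
transitivity (\sum_s \sum_s' x s * x s' * inner H (tnth fs s) (tnth fs s')).
  rewrite /inner.
  under [RHS]eq_bigr => s _ do under eq_bigr => s' _ do rewrite mulr_sumr.
  under [RHS]eq_bigr => s _ do rewrite exchange_big /=.
  rewrite exchange_big /=; apply: eq_bigr => v _.
  rewrite expr2 big_distrlr /= mulr_sumr; apply: eq_bigr => s _.
  by rewrite mulr_sumr; apply: eq_bigr => s' _; rewrite /coord; ring.
apply: eq_bigr => s _; rewrite (bigD1 s) //= fs_orthonormal eqxx mulr1 expr2.
rewrite big1 ?addr0 // => s' /negbTE ns.
by rewrite fs_orthonormal eq_sym ns mulr0.
Qed.

Lemma total_mass : \sum_v vweight H v * norm v ^+ 2 = k%:R.
Proof.
under eq_bigr do rewrite norm_sqr mulr_sumr.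
rewrite exchange_big /= -[k in RHS]card_ord -sumr_const; apply: eq_bigr => s _.
rewrite -[RHS](_ : inner H (tnth fs s) (tnth fs s) = 1).
  by apply: eq_bigr => v _; rewrite expr2 mulrA.
by rewrite fs_orthonormal eqxx.
Qed.

(* If all directions of [T] are close to that of [v], isotropy in this
   direction bounds the mass of [T]. *)
Lemma spreading (T : {set V}) (delta : R) : 0 <= delta <= 2 ->
  (forall u v, u \in T -> v \in T -> \sum_s (dir s u - dir s v) ^+ 2 <= delta) ->
  (\sum_(u in T) vweight H u * norm u ^+ 2) * (1 - delta) <= 1.
Proof.
move=> /andP[d0 d2] close.
have mass_ge0 (u : V) : 0 <= vweight H u * norm u ^+ 2.
  by rewrite mulr_ge0 ?sqr_ge0 ?(ltW (vweight_gt0 H u)).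
have [v /andP[vT nv]|none] := pickP (fun v => (v \in T) && (norm v != 0)); last first.
  rewrite big1 ?mul0r // => u uT.
  by move: (none u); rewrite uT /= => /negbFE/eqP->; rewrite expr0n mulr0.
(* By polarization of unit vectors, the cosine between two directions of [T] is at least
   [1 - delta / 2]. *)
have inner_ge u : u \in T -> norm u * (1 - delta / 2) <= \sum_s dir s v * coord s u.
  move=> uT; have [n0|n0] := eqVneq (norm u) 0.
    rewrite n0 mul0r big1 // => s _.
    by rewrite -norm_dir n0 mul0r mulr0.
  have -> : \sum_s dir s v * coord s u = norm u * \sum_s dir s u * dir s v.
    by rewrite mulr_sumr; apply: eq_bigr => s _; rewrite -norm_dir; ring.
  rewrite ler_wpM2l ?norm_ge0 //.
  have := close u v uT vT.
  have -> : \sum_s (dir s u - dir s v) ^+ 2 = 2 - 2 * \sum_s dir s u * dir s v.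
    transitivity (\sum_s dir s u ^+ 2 + \sum_s dir s v ^+ 2 - 2 * \sum_s dir s u * dir s v).
      rewrite mulr_sumr -big_split -sumrB /=; apply: eq_bigr => s _; ring.
    by rewrite !sum_dir_sqr.
  by move=> ?; lra.
have := isotropy (dir^~ v); rewrite sum_dir_sqr // => iso.
rewrite -[leRHS]iso.
(* The square of [1 - delta / 2] is at least [1 - delta]. *)
apply: (@le_trans _ _ (\sum_(u in T) vweight H u * (norm u * (1 - delta / 2)) ^+ 2)).
  rewrite mulr_suml; apply: ler_sum => u _; rewrite exprMn [leRHS]mulrA.
  rewrite ler_wpM2l ?mass_ge0 //.
  by have := sqr_ge0 delta; rewrite expr2; nra.
rewrite [leRHS](bigID (mem T)) /= -[leLHS]addr0 lerD //; last first.
  by apply: sumr_ge0 => u _; rewrite mulr_ge0 ?sqr_ge0 ?(ltW (vweight_gt0 H u)).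
apply: ler_sum => u uT; rewrite ler_wpM2l ?(ltW (vweight_gt0 H u)) //.
rewrite ler_sqr ?nnegrE ?inner_ge //.
  by rewrite mulr_ge0 ?norm_ge0 //; lra.
apply: le_trans (inner_ge u uT).
by rewrite mulr_ge0 ?norm_ge0 //; lra.
Qed.

End Embedding.

(** * Cells of a shifted grid *)

Section Grid.
Variables (R : realType) (V : finType) (H : hypergraph R V).
Variables (k : nat) (fs : k.-tuple (vec R V)) (eps : R).
Implicit Types (s : 'I_k) (u v : V) (t : R).

(** A cube of this side in dimension [k] has squared diameter [k * side ^+ 2 = eps / 9], the
    closeness fed to [spreading]. *)
Definition side : R := Num.sqrt (eps / k%:R) / 3.
(** With this step, shifts [t < 4 * k / eps] displace the walls by less than [4 / 5 * side], so that
    shifted walls never come within [gap] of the next wall. *)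
Definition gap : R := side * eps / (5 * k%:R).
(** The [6 * k] intervals of length [side] span [2 * sqrt (k * eps)], at least the length 2 of
    [[-1, 1]] when [1 <= k * eps]. The iterated addition matches [range_size] on [RgK 5]. *)
Definition wall_count := iter 5 (addn k) k.
Definition wall t (i : nat) : R := t * gap + i%:R * side - 1.
Definition below t s i v : bool := dir fs s v < wall t i.
Definition same_cell t u v : bool :=
  [forall s : 'I_k, [forall i : 'I_wall_count, below t s i u == below t s i v]].
(** Equal to 1 on the wall, 0 at distance [gap / 2], and negative beyond. *)
Definition wall_proximity t s i v : R := 1 - `|dir fs s v - wall t i| * 2 / gap.
Definition proximity t v : R :=
  \big[Num.max/0]_(s < k) \big[Num.max/0]_(i < wall_count) wall_proximity t s i v.

(* The embedding norm, tapered to 0 at the walls of the grid. *)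
Definition height t v : R := norm fs v * (1 - proximity t v).
Definition height_mass t v : R := vweight H v * height t v ^+ 2.
Definition valid_shift t : bool := t * eps < 4 * k%:R.

Hypotheses (eps_gt0 : 0 < eps) (eps_le1 : eps <= 1) (keps : 1 <= k%:R * eps).

Let k_ge1 : 1 <= k%:R :> R.
Proof. by apply: le_trans keps _; rewrite -[leRHS]mulr1 ler_wpM2l. Qed.

Let k_gt0 : 0 < k%:R :> R.
Proof. exact: lt_le_trans k_ge1. Qed.

Lemma side_sqr : side ^+ 2 = eps / (9 * k%:R).
Proof.
rewrite /side exprMn sqr_sqrtr ?divr_ge0 ?(ltW eps_gt0) ?(ltW k_gt0) //.
by field; rewrite gt_eqF.
Qed.

Lemma side_gt0 : 0 < side.
Proof. by rewrite divr_gt0 // sqrtr_gt0 divr_gt0. Qed.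

Lemma gap_gt0 : 0 < gap.
Proof. by rewrite /gap divr_gt0 // mulr_gt0 ?side_gt0. Qed.

Lemma div_gap_ge0 x : 0 <= x -> 0 <= x / gap.
Proof. by move=> x0; rewrite divr_ge0 // ltW // gap_gt0. Qed.

Lemma gapE : gap * (5 * k%:R) = side * eps.
Proof. by rewrite /gap divfK // gt_eqF // mulr_gt0. Qed.

Lemma gap_le_side : gap * 5 <= side.
Proof.
rewrite -(ler_pM2r k_gt0) -mulrA gapE ler_wpM2l ?(ltW side_gt0) //.
exact: le_trans k_ge1.
Qed.

Lemma side_le1 : side <= 1.
Proof.
rewrite -(@ler_pXn2r _ 2) ?nnegrE ?(ltW side_gt0) // side_sqr expr1n.
rewrite ler_pdivrMr ?mulr_gt0 // mul1r.
by move: k_ge1 eps_le1; lra.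
Qed.

Lemma gap_le1 : gap <= 1.
Proof. by have := side_le1; have := gap_le_side; have := gap_gt0; lra. Qed.

Lemma shift_le_side t : valid_shift t -> t * gap <= side - gap.
Proof.
rewrite /valid_shift => tv; apply: (@le_trans _ _ (4 / 5 * side)); last first.
  by have := gap_le_side; lra.
rewrite -(ler_pM2r (_ : 0 < 5 * k%:R)) ?mulr_gt0 // -[leLHS]mulrA gapE.
have := ler_wpM2l (ltW side_gt0) (ltW tv); lra.
Qed.

Lemma walls_cover : 2 <= wall_count%:R * side.
Proof.
have -> : wall_count%:R = 6 * k%:R :> R by rewrite /wall_count /= !natrD; ring.
have pos : 0 <= 6 * k%:R * side by rewrite mulr_ge0 ?(ltW side_gt0) // mulr_ge0 // ltW.
rewrite -(@ler_pXn2r _ 2) ?nnegrE // exprMn side_sqr.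
have -> : (6 * k%:R) ^+ 2 * (eps / (9 * k%:R)) = 4 * (k%:R * eps) :> R.
  by field; rewrite gt_eqF.
by have := keps; rewrite !expr2; lra.
Qed.

Lemma same_cellP t u v : reflect
  (forall s (i : 'I_wall_count), below t s i u = below t s i v) (same_cell t u v).
Proof.
apply: (iffP forallP) => [h s i|h s]; first by have /forallP/(_ i)/eqP := h s.
by apply/forallP => i; rewrite h.
Qed.

Lemma same_cell_refl t v : same_cell t v v.
Proof. exact/same_cellP. Qed.

Lemma same_cell_sym t u v : same_cell t u v = same_cell t v u.
Proof. by apply/same_cellP/same_cellP => h s i; rewrite h. Qed.

Lemma same_cell_trans t u v w : same_cell t u v -> same_cell t v w -> same_cell t u w.
Proof. by move=> /same_cellP uv /same_cellP vw; apply/same_cellP => s i; rewrite uv vw. Qed.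

(** The first wall above [dir fs s u] is at most [side] above it, and [dir fs s v] lies below the
    same wall. *)
Lemma same_cell_dir t s u v : 0 <= t -> valid_shift t -> same_cell t u v ->
  dir fs s v - dir fs s u <= side.
Proof.
move=> t0 tv /same_cellP same; rewrite leNgt; apply/negP => far.
have := dir_le1 fs s u; have := dir_le1 fs s v.
rewrite !ler_norml => /andP[v1 v2] /andP[u1 u2].
have gap0 := gap_gt0; have side0 := side_gt0; have sl := shift_le_side tv.
have tg0 : 0 <= t * gap by rewrite mulr_ge0 ?(ltW gap0).
have wallS i : wall t i.+1 = wall t i + side by rewrite /wall -natr1; ring.
have count : wall_count = wall_count.-1.+1.
  by rewrite prednK // /wall_count /= addn_gt0 -(ltr0n R) k_gt0.
(* By [far], [dir fs s u < 1 - side]; so the last wall is above it even if that wall lies below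
   1. *)
have ex : exists i, dir fs s u < wall t i.
  exists wall_count.-1.
  have := walls_cover; rewrite {1}count -natr1 /wall => cover.
  by nra.
case: (ex_minnP ex) => i iu imin.
have ltic : (i < wall_count)%N.
  rewrite count ltnS; apply: imin.
  have := walls_cover; rewrite {1}count -natr1 /wall => cover.
  by nra.
have := same s (Ordinal ltic); rewrite /below /= iu => /esym.
apply/negP; rewrite -leNgt; apply: (@le_trans _ _ (dir fs s u + side)); last by lra.
(* Wall 0 is within [side] of -1 by the bound on the shift; any other wall has a predecessor not
   above [dir fs s u]. *)
case: i iu imin {ltic} => [|i] iu imin.
  by rewrite /wall mul0r addr0; lra.
rewrite wallS lerD2r leNgt; apply/negP => /imin; by rewrite ltnn.
Qed.

Lemma proximity_ge0 t v : 0 <= proximity t v.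
Proof. exact: bigmax_ge_id. Qed.

Lemma wall_proximity_le t s (i : 'I_wall_count) v : wall_proximity t s i v <= proximity t v.
Proof.
apply: (bigmax_sup s) => //.
exact: (le_bigmax _ (fun i : 'I_wall_count => wall_proximity t s i v)).
Qed.

Lemma proximity_le t v x : 0 <= x ->
  (forall s (i : 'I_wall_count), wall_proximity t s i v <= x) -> proximity t v <= x.
Proof. by move=> x0 h; apply: bigmax_le => // s _; apply: bigmax_le. Qed.

Lemma proximity_le1 t v : proximity t v <= 1.
Proof.
apply: proximity_le => // s i; rewrite gerBl.
by rewrite divr_ge0 ?(ltW gap_gt0) // mulr_ge0.
Qed.

Lemma height_ge0 t v : 0 <= height t v.
Proof. by rewrite mulr_ge0 ?norm_ge0 // subr_ge0 proximity_le1. Qed.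

Lemma height_le_norm t v : height t v <= norm fs v.
Proof. by rewrite -[leRHS]mulr1 ler_wpM2l ?norm_ge0 // gerBl proximity_ge0. Qed.

Lemma height_mass_ge0 t v : 0 <= height_mass t v.
Proof. by rewrite mulr_ge0 ?sqr_ge0 // ltW ?vweight_gt0. Qed.

Lemma wall_proximity_lipschitz t s i u v :
  wall_proximity t s i u - wall_proximity t s i v <= 2 / gap * `|dir fs s u - dir fs s v|.
Proof.
rewrite [leLHS](_ : _ = 2 / gap * (`|dir fs s v - wall t i| - `|dir fs s u - wall t i|)).
  rewrite ler_wpM2l ?div_gap_ge0 // [leRHS]distrC.
  apply: le_trans (lerB_dist _ _) _.
  have -> : dir fs s v - wall t i - (dir fs s u - wall t i) = dir fs s v - dir fs s u by ring.
  exact: lexx.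
by rewrite /wall_proximity; field; rewrite gt_eqF ?gap_gt0.
Qed.

Lemma norm_dir_sub_gap s u v :
  2 / gap * (norm fs u * `|dir fs s u - dir fs s v|) <= 4 / gap * dist fs u v.
Proof.
apply: (@le_trans _ _ (2 / gap * (2 * dist fs u v))).
  by rewrite ler_wpM2l ?div_gap_ge0 // norm_dir_sub.
by rewrite [leRHS](_ : _ = 2 / gap * (2 * dist fs u v)) //; field; rewrite gt_eqF ?gap_gt0.
Qed.

(** Proximity is [2 / gap]-Lipschitz in each direction coordinate; the factor [norm fs u] converts
    differences of directions into [2 * dist]. *)
Lemma proximity_lipschitz t u v :
  norm fs u * (proximity t u - proximity t v) <= 4 / gap * dist fs u v.
Proof.
have gap0 := gap_gt0.
have c0 : 0 <= 4 / gap * dist fs u v by rewrite mulr_ge0 ?dist_ge0 // div_gap_ge0.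
have [n0|n0] := eqVneq (norm fs u) 0; first by rewrite n0 mul0r.
have npos : 0 < norm fs u by rewrite lt_neqAle eq_sym n0 norm_ge0.
rewrite mulrC -ler_pdivlMr // lerBlDr.
apply: proximity_le => [|s i].
  by rewrite addr_ge0 ?proximity_ge0 ?divr_ge0 ?(ltW npos).
apply: (@le_trans _ _ (4 / gap * dist fs u v / norm fs u + wall_proximity t s i v)); last first.
  by rewrite lerD2l wall_proximity_le.
rewrite -lerBlDr; apply: le_trans (wall_proximity_lipschitz _ _ _ _ _) _.
by rewrite ler_pdivlMr // -[leLHS]mulrA [`|_| * _]mulrC norm_dir_sub_gap.
Qed.

Lemma height_lipschitz t u v :
  height t u - height t v <= (1 + 4 / gap) * dist fs u v.
Proof.
have -> : height t u - height t v = (norm fs u - norm fs v) * (1 - proximity t u)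
    + norm fs v * (proximity t v - proximity t u) by rewrite /height; ring.
rewrite [leRHS]mulrDl mul1r lerD //; last by rewrite distC proximity_lipschitz.
apply: (@le_trans _ _ (`|norm fs u - norm fs v| * 1)); last by rewrite mulr1 norm_sub_le.
apply: le_trans (ler_norm _) _; rewrite normrM ler_wpM2l ?normr_ge0 //.
rewrite ger0_norm ?subr_ge0 ?proximity_le1 //.
by rewrite gerBl proximity_ge0.
Qed.

(** The separating wall is within [|dir u - dir v|] of the direction of [u], where the taper is
    already that small. Hence setting the height to 0 on some of the cells preserves the Lipschitz
    bound. *)
Lemma height_separated t u v : ~~ same_cell t u v -> height t u <= 4 / gap * dist fs u v.
Proof.
rewrite negb_forall => /existsP[s]; rewrite negb_forall => /existsP[i sep].
apply: le_trans (norm_dir_sub_gap s u v).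
rewrite mulrCA ler_wpM2l ?norm_ge0 // lerBlDl.
apply: (@le_trans _ _ (wall_proximity t s i u + 2 / gap * `|dir fs s u - dir fs s v|)).
  rewrite /wall_proximity -addrA lerDl addrC subr_ge0 [leRHS]mulrC -mulrA.
  rewrite [leLHS]mulrC [leRHS]mulrC ler_wpM2l ?div_gap_ge0 //.
  move: sep; rewrite /below.
  case: ltP => lu; case: ltP => lv // _.
    rewrite ltr0_norm ?subr_lt0 // (ler0_norm (_ : dir fs s u - dir fs s v <= 0)).
      by lra.
    by rewrite subr_le0 (le_trans (ltW lu)).
  rewrite ger0_norm ?subr_ge0 // ger0_norm ?subr_ge0; first by lra.
  by rewrite (le_trans (ltW lv)).
by rewrite lerD2r wall_proximity_le.
Qed.

(** A case of [spreading]: each of the [k] direction coordinates varies by at most [side] within a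
    cell. *)
Lemma cell_mass_le t v : 0 <= t -> valid_shift t ->
  orthonormal_family H fs ->
  (\sum_(u | same_cell t u v) height_mass t u) * (1 - eps / 9) <= 1.
Proof.
move=> t0 tv ortho.
have e9 : 0 <= 1 - eps / 9 by move: eps_le1; lra.
apply: le_trans (@spreading R V k fs H ortho [set u | same_cell t u v]%SET (eps / 9) _ _).
- rewrite ler_wpM2r //; under [leRHS]eq_bigl do rewrite inE.
  apply: ler_sum => u _; rewrite ler_wpM2l ?(ltW (vweight_gt0 H u)) //.
  by rewrite ler_sqr ?nnegrE ?height_ge0 ?norm_ge0 ?height_le_norm.
- by move: eps_gt0 eps_le1; lra.
move=> u w; rewrite !inE => uv wv.
have uw : same_cell t u w by apply: same_cell_trans uv _; rewrite same_cell_sym.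
have -> : eps / 9 = \sum_(s < k) side ^+ 2.
  by rewrite sumr_const card_ord -mulr_natl side_sqr; field; rewrite gt_eqF.
apply: ler_sum => s _; rewrite -(real_normK (num_real (_ - _))).
rewrite ler_sqr ?nnegrE ?(ltW side_gt0) ?normr_ge0 //.
rewrite ler_norml lerNl opprB !(@same_cell_dir t) //.
by rewrite same_cell_sym.
Qed.

End Grid.

Lemma sum_unique_le1 (R : realType) (I : finType) (P : pred I) :
  (forall i j, P i -> P j -> i = j) -> \sum_i (P i)%:R <= 1 :> R.
Proof.
move=> uniq; have [i Pi|none] := pickP P; last by rewrite big1 // => i _; rewrite none.
rewrite (bigD1 i) //= Pi big1 ?addr0 // => j ji.
by case Pj: (P j) => //; rewrite (uniq _ _ Pj Pi) eqxx in ji.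
Qed.

(** * Averaging over the shifts of the grid *)

Section Shift.
Variables (R : realType) (V : finType) (H : hypergraph R V).
Variables (k : nat) (fs : k.-tuple (vec R V)) (eps : R).
Hypotheses (eps_gt0 : 0 < eps) (eps_le1 : eps <= 1) (keps : 1 <= k%:R * eps).
Hypothesis fs_orthonormal : orthonormal_family H fs.
Local Notation gap := (gap k eps).
Local Notation side := (side k eps).

Definition good_shift t : bool :=
  valid_shift k eps t && ((1 - eps / 4) * k%:R <= \sum_v height_mass H fs eps t v).

Lemma near_wall t s i v : 0 < wall_proximity fs eps t s i v ->
  `|dir fs s v - wall k eps t i| * 2 < gap.
Proof.
rewrite subr_gt0 ltr_pdivrMr ?mul1r //; exact: gap_gt0.
Qed.

(** Two walls within [gap / 2] of the same point are less than [gap] apart. Different indices would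
    put them at least [side - j * gap >= gap] apart; equal indices leave [j] and [j'] less than 1
    apart. *)
Lemma near_two_walls_le (j j' : nat) s (i i' : nat) v :
  valid_shift k eps j%:R -> valid_shift k eps j'%:R -> (i <= i')%N ->
  0 < wall_proximity fs eps j%:R s i v -> 0 < wall_proximity fs eps j'%:R s i' v ->
  j = j'.
Proof.
move=> vj vj' lei /near_wall ni /near_wall ni'.
have gap0 : 0 < gap by exact: gap_gt0.
have side0 : 0 < side by exact: side_gt0.
have shift := shift_le_side eps_gt0 eps_le1 keps vj.
have : `|wall k eps j%:R i - wall k eps j'%:R i'| < gap.
  rewrite -(ltr_pM2r (_ : 0 < 2)) //.
  apply: le_lt_trans (_ : (`|dir fs s v - wall k eps j%:R i| +
    `|dir fs s v - wall k eps j'%:R i'|) * 2 < _); last by lra.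
  rewrite ler_pM2r // (distrC (dir fs s v) (wall _ _ j%:R _)).
  apply: le_trans (ler_normD _ _); rewrite addrA subrK //; exact: lexx.
rewrite ltr_norml /wall => /andP[lo hi].
have [ltii|] := ltnP i i'.
  have : side <= (i'%:R - i%:R) * side.
    rewrite -[leLHS]mul1r ler_pM2r // -natrB // ler1n subn_gt0 //.
  have : 0 <= j'%:R * gap by rewrite mulr_ge0 // ltW.
  by move=> ? ?; exfalso; lra.
move=> le'; have ei : i = i' by apply/eqP; rewrite eqn_leq lei le'.
rewrite -ei in lo hi.
have {}lo : j'%:R < j%:R + 1 :> R.
  by rewrite -(ltr_pM2r gap0); lra.
have {}hi : j%:R < j'%:R + 1 :> R.
  by rewrite -(ltr_pM2r gap0); lra.
rewrite !natr1 !ltr_nat !ltnS in lo hi.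
by apply/eqP; rewrite eqn_leq hi lo.
Qed.

Definition near (j : nat) (s : 'I_k) v : bool :=
  [exists i : 'I_(wall_count k), 0 < wall_proximity fs eps j%:R s i v].

Lemma near_uniq (j j' : nat) s v : valid_shift k eps j%:R -> valid_shift k eps j'%:R ->
  near j s v -> near j' s v -> j = j'.
Proof.
move=> vj vj' /existsP[i ni] /existsP[i' ni'].
have [le|/ltnW le] := leqP i i'; first exact: near_two_walls_le ni ni'.
by apply/esym; exact: near_two_walls_le ni' ni.
Qed.

(** Union bound over coordinates: far from all walls nothing is lost, and otherwise the left side is
    nonpositive. *)
Lemma height_mass_far (j : nat) v :
  vweight H v * norm fs v ^+ 2 * (1 - \sum_s (near j s v)%:R) <=
  height_mass H fs eps j%:R v.
Proof.
have w0 : 0 <= vweight H v * norm fs v ^+ 2.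
  by rewrite mulr_ge0 ?sqr_ge0 // ltW // vweight_gt0.
have [/existsP[s ns]|no] := boolP [exists s, near j s v].
  apply: le_trans (height_mass_ge0 H fs eps j%:R v).
  apply: mulr_ge0_le0 => //; rewrite subr_le0 (bigD1 s) //= ns lerDl.
  by apply: sumr_ge0.
have -> : height_mass H fs eps j%:R v = vweight H v * norm fs v ^+ 2.
  rewrite /height_mass /height; suff -> : proximity fs eps j%:R v = 0 by rewrite subr0 mulr1.
  apply/le_anti; rewrite proximity_ge0 andbT.
  apply: proximity_le => // s i; rewrite leNgt; apply: contra no => pos.
  by apply/existsP; exists s; apply/existsP; exists i.
by rewrite ler_piMr // gerBl sumr_ge0.
Qed.

(** Each coordinate of a vertex is near a wall for at most one [j < J], so the masses over all
    [j < J] add up to at least [k * (J - k)]. As [4 * k <= J * eps], this is at least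
    [J * (1 - eps / 4) * k], and some [j] reaches the average. *)
Lemma good_shift_exists : exists j : nat, good_shift j%:R.
Proof.
have k0 : 0 < k%:R :> R.
  by rewrite ltNge; apply/negP => le0; move: keps; have := eps_gt0; nra.
have ex : exists J : nat, 4 * k%:R <= J%:R * eps.
  exists (Num.bound (4 * k%:R / eps)).
  rewrite -ler_pdivrMr //; apply/ltW/archi_boundP.
  by rewrite divr_ge0 ?mulr_ge0 // ltW.
(* Minimality of [J] makes every [j < J] a valid shift. *)
case: (ex_minnP ex) => J JP Jmin.
have valid j : (j < J)%N -> valid_shift k eps j%:R.
  by rewrite /valid_shift ltNge; apply: contraTN => /Jmin; rewrite -leqNgt.
have [/existsP[j g]|none] := boolP [exists j : 'I_J, good_shift j%:R]; first by exists j.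
exfalso; have small (j : 'I_J) :
    \sum_v height_mass H fs eps j%:R v < (1 - eps / 4) * k%:R.
  rewrite ltNge; apply: contra none => big; apply/existsP; exists j.
  by rewrite /good_shift valid.
have J0 : (0 < J)%N.
  rewrite lt0n; apply: contraTneq JP => ->; rewrite mul0r -ltNge; by rewrite mulr_gt0.
have : \sum_(j < J) \sum_v height_mass H fs eps j%:R v < J%:R * ((1 - eps / 4) * k%:R).
  rewrite mulr_natl -[J in X in _ < X]card_ord -sumr_const.
  apply: ltr_sum => //; apply/hasP; by exists (Ordinal J0); rewrite ?mem_index_enum.
suff ge : J%:R * ((1 - eps / 4) * k%:R) <= \sum_(j < J) \sum_v height_mass H fs eps j%:R v.
  by move/(le_lt_trans ge); rewrite ltxx.
apply: (@le_trans _ _ (\sum_(j < J) \sum_v vweight H v * norm fs v ^+ 2 *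
    (1 - \sum_s (near j s v)%:R))); last first.
  by apply: ler_sum => j _; apply: ler_sum => v _; exact: height_mass_far.
rewrite exchange_big /=; apply: (@le_trans _ _
  (\sum_v vweight H v * norm fs v ^+ 2 * (J%:R - k%:R))).
  rewrite -mulr_suml total_mass // mulrA [leLHS]mulrC ler_pM2l //.
  by move: JP; lra.
apply: ler_sum => v _; rewrite -mulr_sumr ler_wpM2l //.
  by rewrite mulr_ge0 ?sqr_ge0 // ltW // vweight_gt0.
rewrite sumrB sumr_const card_ord lerD2l lerN2 exchange_big /=.
rewrite -[k in leRHS]card_ord -sumr_const; apply: ler_sum => s _.
apply: sum_unique_le1 => j j' nj nj'; apply: val_inj.
exact: near_uniq (valid _ (ltn_ord j)) (valid _ (ltn_ord j')) nj nj'.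
Qed.

End Shift.

(** * Packing cells into groups of constant mass *)

Section Packing.
Variables (R : realType) (V : finType) (A big : pred V) (key : V -> nat) (load : V -> R).
Hypotheses (key_inj : injective key)
  (load_big : forall v, big v -> load v = 1)
  (load_small : forall v, ~~ big v -> 0 <= load v <= 1 / 2)
  (big_first : forall u v, big v -> (key u < key v)%N -> big u).

(** The left end of [v] when the loads are laid end to end in the order of [key]. *)
Definition offset v : R := \sum_(u | A u && (key u < key v)%N) load u.

Let load_ge0 v : 0 <= load v.
Proof.
by case: (boolP (big v)) => [/load_big->|/load_small/andP[]]; rewrite ?ler01.
Qed.

Let offset_big v : big v -> exists n : nat, offset v = n%:R.
Proof.
move=> bv; exists #|[pred u | A u && (key u < key v)%N]|.
rewrite /offset -sumr_const; apply: eq_bigr => u /andP[_ lt].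
by rewrite load_big // (big_first bv lt).
Qed.

(** Only the last item starting before [i] can overrun [i]. A small one does so by at most [1 / 2];
    a big one starts at an integer, as only big ones precede it, and has length 1, so it does not
    overrun. *)
Lemma load_before_le (i : nat) :
  \sum_(u | A u && (offset u < i%:R)) load u <= i%:R + 1 / 2.
Proof.
have [v0 v0P|none] := pickP (fun u => A u && (offset u < i%:R)); last first.
  by rewrite big_pred0 // addr_ge0 // divr_ge0.
case: (@arg_maxnP _ v0 (fun u => A u && (offset u < i%:R)) key v0P) => v /andP[Av ltv] vmax.
apply: (@le_trans _ _ (offset v + load v)).
  rewrite (bigD1 v) ?Av //= addrC lerD2r.
  rewrite [leLHS]big_mkcond [leRHS]big_mkcond /=; apply: ler_sum => u _.
  case: ifP => [/andP[uP uv]|_]; last by case: ifP.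
  have le : (key u <= key v)%N := vmax u uP.
  by rewrite (andP uP).1 ltn_neqAle le (inj_eq key_inj) uv.
case: (boolP (big v)) => [bv|sv].
  have [n nE] := offset_big bv; rewrite load_big // nE; rewrite nE ltr_nat in ltv.
  have : n.+1%:R <= i%:R :> R by rewrite ler_nat.
  by rewrite -natr1 => le; lra.
by have /andP[_ small] := load_small sv; lra.
Qed.

Lemma load_before_ge (i : nat) : i%:R <= \sum_(u | A u) load u ->
  i%:R <= \sum_(u | A u && (offset u < i%:R)) load u.
Proof.
move=> tot.
have [v0 v0P|none] := pickP (fun u => A u && (i%:R <= offset u)); last first.
  rewrite (eq_bigl A) // => u; case Au: (A u) => //=.
  by have := none u; rewrite Au /= leNgt => /negbFE.
case: (@arg_minnP _ v0 (fun u => A u && (i%:R <= offset u)) key v0P) => v /andP[Av lev] vmin.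
apply: le_trans lev _; rewrite /offset [leLHS]big_mkcond [leRHS]big_mkcond /=.
apply: ler_sum => u _; case: ifP => [/andP[Au lt]|_]; last by case: ifP.
rewrite Au /= ifT // ltNge; apply/negP => le.
by have := vmin u; rewrite Au le leqNgt lt => /(_ isT).
Qed.

(** The items starting in the unit interval after [i] carry at least [(i + 1) - (i + 1 / 2)]. *)
Lemma packing (i : nat) : i.+1%:R <= \sum_(u | A u) load u ->
  1 / 2 <= \sum_(u | A u && (i%:R <= offset u < i.+1%:R)) load u.
Proof.
move=> tot; have := load_before_ge tot; have := load_before_le i.
have -> : \sum_(u | A u && (offset u < i.+1%:R)) load u =
  \sum_(u | A u && (offset u < i%:R)) load u +
  \sum_(u | A u && (i%:R <= offset u < i.+1%:R)) load u.
  rewrite (bigID (fun u => offset u < i%:R)) /=; congr (_ + _); apply: eq_bigl => u.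
    rewrite -andbA; congr (_ && _); apply/andP/idP => [[]//|lt]; split=> //.
    by rewrite (lt_trans lt) // ltr_nat.
  by rewrite -andbA -leNgt [(_ < _) && _]andbC.
by have := @natr1 R i; set a := \sum_(u | _) _; set b := \sum_(u | _) _ => *; lra.
Qed.

End Packing.

(** * Cells of the grid, their representatives and their groups *)

Section Groups.
Variables (R : realType) (V : finType) (H : hypergraph R V).
Variables (k : nat) (fs : k.-tuple (vec R V)) (eps : R).
Implicit Types (t : R) (u v r : V).
Local Notation same_cell := (same_cell fs eps).
Local Notation height_mass := (height_mass H fs eps).

Definition cell_mass t v : R := \sum_(u | same_cell t u v) height_mass t u.
Definition heavy t v : bool := 1 / 2 <= cell_mass t v.
Definition representative t v : bool :=
  [forall u, same_cell t u v ==> (enum_rank v <= enum_rank u)%N].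

(* Heavy cells come first, each filling a unit interval alone; the other cells
   are laid end to end after them. *)
Definition load t v : R := if heavy t v then 1 else cell_mass t v.
Definition key t v : nat := ((if heavy t v then 0 else #|V|) + enum_rank v)%N.
Definition position t v : R :=
  \sum_(u | representative t u && (key t u < key t v)%N) load t u.
Definition group t (i : nat) : {set V} :=
  [set v | [exists r, [&& representative t r, same_cell t v r &
                          i%:R <= position t r < i.+1%:R]]]%SET.

Lemma representative_uniq t r r' :
  representative t r -> representative t r' -> same_cell t r r' -> r = r'.
Proof.
move=> /forallP rr /forallP rr' same; apply/enum_rank_inj/val_inj/eqP.
have := rr r'; have := rr' r; rewrite same same_cell_sym same /= => le le'.
by rewrite eqn_leq le le'.
Qed.

Lemma representative_exists t v : exists2 r, representative t r & same_cell t v r.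
Proof.
case: (@arg_minnP _ v (fun u => same_cell t u v) (fun u => enum_rank u : nat)).
  exact: same_cell_refl.
move=> r rv rmin; exists r; last by rewrite same_cell_sym.
by apply/forallP => u; apply/implyP => ur; apply: rmin; exact: same_cell_trans ur rv.
Qed.

(** Each vertex belongs to the cell of exactly one representative, so double sums over selected
    cells collapse. *)
Lemma sum_cells t (P : pred V) (F : V -> R) :
  \sum_(r | representative t r && P r) \sum_(v | same_cell t v r) F v =
  \sum_(v | [exists r, [&& representative t r, same_cell t v r & P r]]) F v.
Proof.
rewrite (exchange_big_dep xpredT) //= [RHS]big_mkcond; apply: eq_bigr => v _.
case: ifP => [/existsP[r /and3P[rr vr Pr]]|/negbT no].
  rewrite (big_pred1 r) // => r' /=; apply/idP/eqP => [/andP[/andP[rr' _] vr']|->].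
    apply: representative_uniq rr' rr _.
    by apply: same_cell_trans vr; rewrite same_cell_sym.
  by rewrite rr Pr vr.
rewrite big_pred0 // => r; apply: contraNF no => /andP[/andP[rr Pr] vr].
by apply/existsP; exists r; rewrite rr vr Pr.
Qed.

Lemma key_inj t : injective (key t).
Proof.
move=> u v; rewrite /key => e; apply/enum_rank_inj/ord_inj; move: e.
have lu : (enum_rank u < #|V|)%N := ltn_ord _.
have lv : (enum_rank v < #|V|)%N := ltn_ord _.
move: (nat_of_ord (enum_rank u)) (nat_of_ord (enum_rank v)) lu lv => a b.
move: #|V| => n ltan ltbn.
by case: ifP => _; case: ifP => _; lia.
Qed.

Lemma load_small t v : ~~ heavy t v -> 0 <= load t v <= 1 / 2.
Proof.
move=> sv; rewrite /load (negbTE sv) sumr_ge0 => [|u _]; last exact: height_mass_ge0.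
by rewrite ltW // ltNge.
Qed.

Lemma heavy_first t u v : heavy t v -> (key t u < key t v)%N -> heavy t u.
Proof.
move=> hv; rewrite /key hv; case: ifP => // _.
have lv : (enum_rank v < #|V|)%N := ltn_ord _.
by rewrite add0n ltnNge (leq_trans (ltnW lv)) ?leq_addr.
Qed.

Lemma group_closed t i u v : same_cell t u v -> (u \in group t i) = (v \in group t i).
Proof.
move=> uv; rewrite !inE; apply/existsP/existsP => -[r /and3P[rr sr ir]]; exists r.
  by rewrite rr ir andbT /=; apply: same_cell_trans sr; rewrite same_cell_sym.
by rewrite rr ir andbT /=; apply: same_cell_trans uv sr.
Qed.

Lemma group_disjoint t (i j : nat) : i != j -> [disjoint group t i & group t j].
Proof.
move=> ij; apply/pred0P => v /=; apply: contraNF ij => /andP[]; rewrite !inE.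
move=> /existsP[r /and3P[rr vr ir]] /existsP[r' /and3P[rr' vr' jr]].
have e : r = r'.
  by apply: representative_uniq rr rr' _; apply: same_cell_trans vr'; rewrite same_cell_sym.
rewrite -e in jr; move: ir jr => /andP[i1 i2] /andP[j1 j2].
have := le_lt_trans i1 j2; have := le_lt_trans j1 i2; rewrite !ltr_nat !ltnS => a b.
by rewrite eqn_leq a b.
Qed.

Hypotheses (eps_gt0 : 0 < eps) (eps_le1 : eps <= 1) (keps : 1 <= k%:R * eps).
Hypothesis fs_orthonormal : orthonormal_family H fs.

(** The loads total at least [(1 - eps / 9) * (1 - eps / 4) * k >= (1 - eps) * k], since
    [1 - eps / 9] times the mass of a cell never exceeds its load; then [packing] applies. *)
Lemma group_mass t (i : nat) : 0 <= t -> good_shift H fs eps t ->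
  i.+1%:R <= (1 - eps) * k%:R ->
  1 / 2 <= \sum_(v in group t i) height_mass t v.
Proof.
move=> t0 /andP[tv tm] ik.
have mass_ge0 (u : V) : 0 <= height_mass t u by exact: height_mass_ge0.
have tot : i.+1%:R <= \sum_(r | representative t r) load t r.
  apply: le_trans ik _.
  have cell : (1 - eps / 9) * (\sum_v height_mass t v) <= \sum_(r | representative t r) load t r.
    have -> : \sum_v height_mass t v = \sum_(r | representative t r) cell_mass t r.
      transitivity (\sum_(r | representative t r && true) cell_mass t r); last first.
        by apply: eq_bigl => r; rewrite andbT.
      rewrite (sum_cells t xpredT); apply: eq_bigl => v; apply/esym/existsP.
      by have [r rr vr] := representative_exists t v; exists r; rewrite rr vr.
    rewrite mulr_sumr; apply: ler_sum => r _; rewrite /load.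
    case: ifP => _; first by rewrite mulrC cell_mass_le.
    rewrite ler_piMl ?sumr_ge0 //.
    by move: eps_gt0; lra.
  apply: le_trans cell; have k0 : 0 <= k%:R :> R by [].
  apply: (@le_trans _ _ ((1 - eps / 9) * ((1 - eps / 4) * k%:R))); last first.
    by rewrite ler_wpM2l //; move: eps_le1; lra.
  rewrite mulrA ler_wpM2r //; move: eps_gt0 eps_le1 => e0 e1; nra.
have load1 v : heavy t v -> load t v = 1 by rewrite /load => ->.
have pk := packing (@key_inj t) load1 (@load_small t) (@heavy_first t) tot.
have -> : \sum_(v in group t i) height_mass t v =
    \sum_(r | representative t r && (i%:R <= position t r < i.+1%:R)) cell_mass t r.
  by rewrite sum_cells; apply: eq_bigl => v; rewrite inE.
have cell0 r : 0 <= cell_mass t r by exact: sumr_ge0.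
(* The load of a heavy cell may exceed its mass, but such a cell alone has mass [1 / 2]; in a group
   without heavy cells, loads are masses. *)
have [r /and3P[rr ri hr]|none] := pickP (fun r => [&& representative t r,
    i%:R <= position t r < i.+1%:R & heavy t r]).
  rewrite (bigD1 r) ?rr //=; apply: le_trans hr _; rewrite lerDl sumr_ge0 //.
apply: le_trans pk _; apply: ler_sum => r /andP[rr ri].
have := none r; rewrite rr ri /= => nh; rewrite /load nh; exact: lexx.
Qed.

End Groups.

(** * Clusters *)

Section Clusters.
Variables (R : realType) (V : finType) (H : hypergraph R V).
Variables (k : nat) (fs : k.-tuple (vec R V)) (eps : R).
Implicit Types (t : R) (u v z : V).
Local Notation height := (height fs eps).
Local Notation group := (group H fs eps).
Local Notation good_shift := (good_shift H fs eps).

Definition sweep_set t i z : {set V} :=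
  [set v | (v \in group t i) && (height t z <= height t v)]%SET.
Definition candidate t i z : bool := (z \in group t i) && (0 < height t z).
Definition best t i z : bool :=
  candidate t i z && [forall z', candidate t i z' ==>
    (expansion H (sweep_set t i z) <= expansion H (sweep_set t i z'))].
(** Ties between optimal thresholds are settled without a choice: the optimal sweep sets are nested,
    and their union is the one with the lowest threshold. *)
Definition cluster t i : {set V} :=
  [set v | (v \in group t i) && [exists z, best t i z && (height t z <= height t v)]]%SET.

(* The grid is shifted by multiples of [gap], indexed by pairs of base 2k digits. *)
Definition shift (a b : nat) : R := a%:R * (k + k)%:R + b%:R.
Definition chosen (a b : nat) : bool :=
  good_shift (shift a b) &&
  [forall a' : 'I_(k + k), [forall b' : 'I_(k + k),
     (shift a' b' < shift a b) ==> ~~ good_shift (shift a' b')]].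
Definition output_set i : {set V} :=
  [set v | [exists a : 'I_(k + k), [exists b : 'I_(k + k),
     chosen a b && (v \in cluster (shift a b) i)]]]%SET.

Lemma shift_ge0 a b : 0 <= shift a b.
Proof. by rewrite addr_ge0 ?mulr_ge0. Qed.

Lemma candidate_best t i z : candidate t i z -> exists z', best t i z'.
Proof.
move=> cz; exists [arg min_(u < z | candidate t i u) expansion H (sweep_set t i u)]%O.
case: arg_minP => // z' cz' zmin; rewrite /best cz' /=.
by apply/forallP => u; apply/implyP; exact: zmin.
Qed.

Lemma cluster_sweep t i z : candidate t i z ->
  exists2 z', best t i z' & cluster t i = sweep_set t i z'.
Proof.
move=> /candidate_best[z0 b0].
pose z' := [arg min_(u < z0 | best t i u) height t u]%O.
have [b' zmin] : best t i z' /\ forall u, best t i u -> height t z' <= height t u.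
  by rewrite /z'; case: arg_minP.
exists z' => //; apply/setP => v; rewrite !inE; congr (_ && _).
apply/existsP/idP => [[u /andP[bu le]]|le]; first exact: le_trans (zmin u bu) le.
by exists z'; rewrite b'.
Qed.

Hypotheses (eps_gt0 : 0 < eps) (eps_le1 : eps <= 1) (keps : 1 <= k%:R * eps).
Hypothesis fs_orthonormal : orthonormal_family H fs.

(** A valid shift satisfies [j * eps < 4 * k <= 4 * k * (k * eps)], so the least good one is below
    [(2 * k) ^ 2] and has two digits in base [2 * k]. *)
Lemma chosen_exists : exists a b : 'I_(k + k), chosen a b.
Proof.
have [j0 g0] := good_shift_exists eps_gt0 eps_le1 keps fs_orthonormal.
have ex : exists j : nat, good_shift j%:R by exists j0.
case: (ex_minnP ex) => j gj jmin {j0 g0 ex}.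
have k0 : (0 < k)%N.
  by case: (k) keps => //; rewrite mul0r leNgt ltr01.
have ltj : (j < (k + k) * (k + k))%N.
  have /andP[jv _] := gj; rewrite /valid_shift in jv.
  rewrite -(ltr_nat R) -(ltr_pM2r eps_gt0); apply: lt_le_trans jv _.
  have -> : ((k + k) * (k + k))%:R * eps = 4 * k%:R * (k%:R * eps) :> R.
    by rewrite natrM natrD; ring.
  by rewrite -[leLHS]mulr1 ler_wpM2l ?mulr_ge0.
have shiftE (a b : nat) : shift a b = (a * (k + k) + b)%:R.
  by rewrite [in RHS]natrD [in RHS]natrM.
have kk0 : (0 < k + k)%N by rewrite addn_gt0 k0.
have ltq : (j %/ (k + k) < k + k)%N by rewrite ltn_divLR.
have ltr : (j %% (k + k) < k + k)%N by rewrite ltn_mod.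
exists (Ordinal ltq), (Ordinal ltr); rewrite /chosen /= shiftE -divn_eq gj /=.
apply/forallP => a; apply/forallP => b; apply/implyP; rewrite shiftE ltr_nat => lt.
by apply: contraL lt => /jmin; rewrite -leqNgt.
Qed.

(** By minimality all chosen pairs encode the same shift, which is thus common to all [i]. *)
Lemma output_set_cluster : exists2 t, 0 <= t /\ good_shift t &
  forall i, output_set i = cluster t i.
Proof.
have [a [b cab]] := chosen_exists; exists (shift a b).
  by split; [exact: shift_ge0 | have /andP[] := cab].
move=> i; apply/setP => v; rewrite inE; apply/existsP/idP => [[a' /existsP[b']]|vi].
  move=> /andP[cab']; suff -> : shift a' b' = shift a b by [].
  apply/eqP; rewrite eq_le !leNgt.
  have /andP[g /forallP m] := cab; have /andP[g' /forallP m'] := cab'.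
  have /forallP/(_ b') := m a'; have /forallP/(_ b) := m' a; rewrite g g' /=.
  by case: ltP => //=; case: ltP.
by exists a; apply/existsP; exists b; rewrite cab.
Qed.

Variable xi : R.
Hypothesis fs_discrepancy : forall s, discrepancy H (tnth fs s) <= xi.

Lemma edge_max_ge (f : vec R V) (e : {set V}) u v : u \in e -> v \in e ->
  (f u - f v) ^+ 2 <= edge_max f e.
Proof.
move=> ue ve; apply: (bigmax_sup u) => //.
exact: (le_bigmax_cond _ (fun v => (f u - f v) ^+ 2)).
Qed.

Lemma edge_max_ge0 (f : vec R V) (e : {set V}) : 0 <= edge_max f e.
Proof. exact: bigmax_ge_id. Qed.

Lemma energy_le : \sum_(e in edges H) weight H e * (\sum_s edge_max (tnth fs s) e) <= k%:R * xi.
Proof.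
under eq_bigr do rewrite mulr_sumr.
rewrite exchange_big /= mulr_natl -[k in leRHS]card_ord -sumr_const.
apply: ler_sum => s _; apply: le_trans (fs_discrepancy s); rewrite /discrepancy.
have -> : \sum_u vweight H u * (tnth fs s : vec R V) u ^+ 2 = 1.
  transitivity (inner H (tnth fs s) (tnth fs s)); last by rewrite fs_orthonormal eqxx.
  by apply: eq_bigr => u _; rewrite expr2 mulrA.
by rewrite divr1.
Qed.

Lemma expansion_ge0 (S : {set V}) : 0 <= expansion H S.
Proof.
rewrite divr_ge0 ?sumr_ge0 // => [e /boundaryP[ee _ _]|v _]; first exact: weight_ge0.
exact/ltW/vweight_gt0.
Qed.

(** [sweep_cut] for the height restricted to the group, with Lipschitz constant [1 + 4 / gap]; the
    mass [1 / 2] of the group turns the factor 4 into 8. *)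
Lemma cluster_expansion t (i : nat) : 0 <= t -> good_shift t ->
  i.+1%:R <= (1 - eps) * k%:R ->
  cluster t i != finset.set0 /\
  expansion H (cluster t i) ^+ 2 <= 8 * (1 + 4 / gap k eps) ^+ 2 * (k%:R * xi).
Proof.
move=> t0 gt ik; have mass := group_mass eps_gt0 eps_le1 keps fs_orthonormal t0 gt ik.
have h0 v : 0 <= height t v by exact: height_ge0.
have [z cz] : exists z, candidate t i z.
  apply/existsP; apply: contraT; rewrite negb_exists => /forallP no.
  move: mass; rewrite big1 => [|v vi]; first by rewrite leNgt divr_gt0.
  suff -> : height_mass H fs eps t v = 0 by [].
  have := no v; rewrite /candidate vi -leNgt /= => hv.
  by rewrite /height_mass (_ : height t v = 0) ?expr0n ?mulr0 //; apply/le_anti; rewrite hv h0.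
have [z' /andP[/andP[zi hz'] /forallP zbest] ->] := cluster_sweep cz.
split; first by apply/set0Pn; exists z'; rewrite inE zi lexx.
set theta := expansion H _ in zbest *.
set L := 1 + 4 / gap k eps.
have xi0 : 0 <= k%:R * xi.
  apply: le_trans energy_le; apply: sumr_ge0 => e ee.
  rewrite mulr_ge0 ?weight_ge0 // sumr_ge0 // => s _; exact: edge_max_ge0.
have [th0|th0] := leP theta 0.
  have -> : theta = 0 by apply/le_anti; rewrite th0 expansion_ge0.
  by rewrite expr0n /= mulr_ge0 // mulr_ge0 // sqr_ge0.
have gap0 : 0 < gap k eps by exact: gap_gt0.
have q0 : 0 <= 4 / gap k eps by rewrite divr_ge0 // ltW.
have L0 : 0 <= L by rewrite addr_ge0.
pose g v := if v \in group t i then height t v else 0.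
have g0 v : 0 <= g v by rewrite /g; case: ifP.
pose D (e : {set V}) := L * Num.sqrt (\sum_s edge_max (tnth fs s) e).
have distD (e : {set V}) u v : u \in e -> v \in e -> L * dist fs u v <= D e.
  move=> ue ve; rewrite ler_wpM2l // ler_wsqrtr //.
  by apply: ler_sum => s _; exact: edge_max_ge.
have gD e u v : e \in edges H -> u \in e -> v \in e -> g u - g v <= D e.
  move=> ee ue ve; apply: le_trans (distD e u v ue ve).
  (* Vertices of one cell are both in the group or both outside; for separated vertices the height
     of [u] alone is small enough. *)
  have [same|sep] := boolP (same_cell fs eps t u v).
    rewrite /g (group_closed _ _ same); case: ifP => _; first exact: height_lipschitz.
    by rewrite subr0 mulr_ge0 ?dist_ge0.
  apply: (@le_trans _ _ (height t u)).
    rewrite lerBlDr (@le_trans _ _ (height t u + 0)) ?lerD2l // addr0 /g.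
    by case: ifP.
  apply: le_trans (height_separated eps_gt0 eps_le1 keps sep) _.
  by rewrite ler_wpM2r ?dist_ge0 // lerDr.
have sweepP z0 : 0 < g z0 -> theta <= expansion H [set v | g z0 <= g v]%SET.
  rewrite {1}/g; case: ifP; rewrite ?ltxx // => z0i hz0.
  have := zbest z0; rewrite /candidate z0i hz0 /= => le; apply: le_trans le _.
  suff -> : sweep_set t i z0 = [set v | g z0 <= g v]%SET by [].
  apply/setP => v; rewrite /sweep_set [LHS]finset.inE [RHS]finset.inE /g z0i; case: ifP => //= _.
  by rewrite leNgt hz0.
have := sweep_cut g0 th0 gD sweepP.
have -> : \sum_v vweight H v * g v ^+ 2 = \sum_(v in group t i) height_mass H fs eps t v.
  rewrite [RHS]big_mkcond; apply: eq_bigr => v _; rewrite /g.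
  by case: ifP; rewrite // expr0n mulr0.
have -> : \sum_(e in edges H) weight H e * D e ^+ 2 =
    L ^+ 2 * \sum_(e in edges H) weight H e * (\sum_s edge_max (tnth fs s) e).
  rewrite mulr_sumr; apply: eq_bigr => e _; rewrite exprMn sqr_sqrtr 1?mulrCA //.
  by apply: sumr_ge0 => s _; exact: edge_max_ge0.
move=> main; have e1 := ler_wpM2l (sqr_ge0 L) energy_le.
have e2 := ler_wpM2l (sqr_ge0 theta) mass.
have -> : 8 * L ^+ 2 * (k%:R * xi) = 8 * (L ^+ 2 * (k%:R * xi)) by rewrite mulrA.
by lra.
Qed.

Lemma cluster_disjoint t (i j : nat) : i != j -> [disjoint cluster t i & cluster t j].
Proof.
move=> ij; apply: disjointW (group_disjoint H fs eps t ij);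
  by apply/fintype.subsetP => v; rewrite inE => /andP[].
Qed.

End Clusters.

(** From [ln (3 / 4) <= - 1 / 4] and [1 / 4 < (3 / 4) ^ 4]. It makes [ln (ln 4)] positive, hence the
    iterated logarithm bounded away from 0. *)
Lemma ln4_gt1 (R : realType) : 1 < ln 4 :> R.
Proof.
have e : ln (3 / 4 : R) <= - (1 / 4).
  have := @le_ln1Dx R (- (1 / 4)); rewrite (_ : 1 + - (1 / 4) = 3 / 4 :> R); last by field.
  by apply; lra.
have l : ln (4^-1 : R) < ln ((3 / 4) ^+ 4).
  by rewrite ltr_ln ?posrE ?exprn_gt0 ?invr_gt0 ?divr_gt0 //; lra.
rewrite lnV ?posrE // lnXn ?divr_gt0 // -[ltRHS]mulr_natl in l.
by lra.
Qed.

(** * From the grid parameters to the bound of the statement *)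

Section Bound.
Variables (R : realType) (V : finType) (H : hypergraph R V).
Variables (k : nat) (fs : k.-tuple (vec R V)) (xi eps : R).
Hypotheses (k_gt0 : (0 < k)%N) (fs_orthonormal : orthonormal_family H fs)
  (fs_discrepancy : forall s : 'I_k, discrepancy H (tnth fs s) <= xi)
  (eps_ge : 1 / k%:R <= eps).

(** The denominator is the product of the least values of the three logarithmic factors; 225 comes
    from [gap ^+ 2 = eps ^+ 3 / (225 * k ^+ 3)]. *)
Definition cheeger_constant : R := 225 / (ln 4 * ln (ln 4) * Num.sqrt (ln 2)).

Lemma cheeger_constant_gt0 : 0 < cheeger_constant.
Proof.
have l4 := ln4_gt1 R.
by rewrite divr_gt0 // !mulr_gt0 ?sqrtr_gt0 ?ln_gt0 ?ltr1n // (lt_trans _ l4).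
Qed.

Let kR_gt0 : 0 < k%:R :> R. Proof. by rewrite ltr0n. Qed.
Let eps_gt0 : 0 < eps. Proof. by apply: lt_le_trans eps_ge; rewrite divr_gt0. Qed.
Let keps : 1 <= k%:R * eps. Proof. by rewrite mulrC -ler_pdivrMr. Qed.

Lemma boundary_rank (S e : {set V}) : e \in boundary H S -> (1 < edge_rank H)%N.
Proof.
case/boundaryP => ee [u ue uS] [v ve vS].
rewrite /edge_rank (bigD1 e ee) /= leq_max; apply/orP; left.
rewrite (cardsD1 u) ue (cardsD1 v) !inE ve andbT.
by case: eqVneq vS => // ->; rewrite uS.
Qed.

(** Since [4 * eps * (1 - eps) <= 1 <= (1 - eps) * k]. *)
Lemma ratio_ge4 : 1 <= (1 - eps) * k%:R -> 4 <= k%:R / eps.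
Proof.
move=> ge1; rewrite ler_pdivlMr //.
have e1 : 0 < 1 - eps by rewrite -(pmulr_lgt0 _ kR_gt0); exact: lt_le_trans ge1.
rewrite -(ler_pM2l e1); apply: le_trans ge1.
by have := sqr_ge0 (2 * eps - 1); rewrite expr2; nra.
Qed.

Lemma eps_pow_sqr : (eps `^ (3 / 2)) ^+ 2 = eps ^+ 3.
Proof.
rewrite -powR_mulrn ?powR_ge0 // -powRrM -powR_mulrn ?(ltW eps_gt0) //.
by congr (_ `^ _); field.
Qed.

Lemma expansion_le_cheeger (S : {set V}) : 0 <= xi -> 1 <= (1 - eps) * k%:R ->
  expansion H S ^+ 2 <= 8 * (1 + 4 / gap k eps) ^+ 2 * (k%:R * xi) ->
  expansion H S <= cheeger_constant * cheeger_bound H k eps xi.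
Proof.
move=> xi0 ge1 sq; have l4 := ln4_gt1 R; have r4 := ratio_ge4 ge1.
have l4_gt0 : 0 < ln 4 :> R by exact: lt_trans l4.
have ll4_gt0 : 0 < ln (ln 4) :> R by rewrite ln_gt0.
have p_gt0 : 0 < eps `^ (3 / 2) by rewrite powR_gt0.
have eps_le1 : eps <= 1.
  rewrite -subr_ge0 -(pmulr_lge0 _ kR_gt0); exact: le_trans ge1.
have A_ge : ln 4 <= ln (k%:R / eps) by rewrite ler_ln ?posrE // (lt_le_trans _ r4).
have B_ge : ln (ln 4) <= ln (ln (k%:R / eps)).
  by rewrite ler_ln ?posrE // (lt_le_trans _ A_ge).
have A0 := lt_le_trans l4_gt0 A_ge; have B0 := lt_le_trans ll4_gt0 B_ge.
have bound0 : 0 <= cheeger_constant * cheeger_bound H k eps xi.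
  rewrite mulr_ge0 ?(ltW cheeger_constant_gt0) // /cheeger_bound.
  rewrite mulr_ge0 ?sqrtr_ge0 // mulr_ge0 ?sqrtr_ge0 // mulr_ge0 ?(ltW B0) //.
  by rewrite mulr_ge0 ?(ltW A0) // divr_ge0 ?exprn_ge0 // ltW.
(* With no hyperedge cut the expansion is 0; this covers rank 1, where the factor [ln r]
   vanishes. *)
have [e eS|none] := pickP (mem (boundary H S)); last first.
  suff -> : expansion H S = 0 by [].
  by rewrite /expansion big_pred0 ?mul0r // => e; exact: none.
have rank := boundary_rank eS.
have S_ge : Num.sqrt (ln 2) <= Num.sqrt (ln (edge_rank H)%:R) :> R.
  by rewrite ler_wsqrtr // ler_ln ?posrE ?ltr0n ?ler_nat // ltnW.
have s2 : 0 < Num.sqrt (ln 2) :> R by rewrite sqrtr_gt0 ln_gt0 // ltr1n.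
pose X : R := k%:R ^+ 2 / eps `^ (3 / 2) * Num.sqrt xi.
have X0 : 0 <= X by rewrite mulr_ge0 ?sqrtr_ge0 // divr_ge0 ?exprn_ge0 // ltW.
have X225 : 0 <= 225 * X by exact: mulr_ge0.
apply: (@le_trans _ _ (225 * X)); last first.
  have -> : cheeger_constant * cheeger_bound H k eps xi = 225 * X *
      (ln (k%:R / eps) / ln 4 * (ln (ln (k%:R / eps)) / ln (ln 4)) *
       (Num.sqrt (ln (edge_rank H)%:R) / Num.sqrt (ln 2))).
    rewrite /cheeger_constant /cheeger_bound /X; field.
    by rewrite !gt_eqF.
  rewrite -[leLHS]mulr1 ler_wpM2l //.
  have q a b : 0 < a -> a <= b -> 1 <= b / a :> R by move=> a0; rewrite ler_pdivlMr // mul1r.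
  have m a b : 1 <= a -> 1 <= b -> 1 <= a * b :> R.
    by move=> a1 b1; rewrite -[leLHS]mulr1 ler_pM.
  by apply: (m _ _ (m _ _ _ _)); apply: q.
have gap0 : 0 < gap k eps by exact: gap_gt0.
rewrite -ler_sqr ?nnegrE //; last exact: expansion_ge0.
apply: le_trans sq _.
have gap_sqr : gap k eps ^+ 2 = eps ^+ 3 / (225 * k%:R ^+ 3).
  rewrite /gap exprMn exprMn side_sqr ?eps_le1 ?eps_gt0 //.
  by field; rewrite gt_eqF.
have L5 : (1 + 4 / gap k eps) ^+ 2 <= 25 / gap k eps ^+ 2.
  have -> : 25 / gap k eps ^+ 2 = (5 / gap k eps) ^+ 2 by field; rewrite gt_eqF.
  have gapV0 : 0 <= (gap k eps)^-1 by rewrite invr_ge0 ltW.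
  rewrite ler_sqr ?nnegrE; [| by lra | by lra].
  have : 1 <= (gap k eps)^-1 by rewrite invf_ge1 // gap_le1.
  by move=> ?; lra.
have X2 : (225 * X) ^+ 2 = 225 * (225 * (k%:R ^+ 4 * xi / eps ^+ 3)).
  rewrite /X !exprMn sqr_sqrtr // exprVn eps_pow_sqr.
  by field; rewrite gt_eqF.
rewrite X2; apply: (@le_trans _ _ (8 * (25 / gap k eps ^+ 2) * (k%:R * xi))).
  by rewrite ler_wpM2r ?mulr_ge0 // ler_wpM2l.
(* The factor [8 * 25 = 200] is below 225. *)
rewrite gap_sqr [leLHS](_ : _ = 200 * (225 * (k%:R ^+ 4 * xi / eps ^+ 3))).
  rewrite ler_wpM2r ?ler_nat // mulr_ge0 // divr_ge0 ?exprn_ge0 ?(ltW eps_gt0) //.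
  by rewrite mulr_ge0 ?exprn_ge0.
by field; rewrite !gt_eqF.
Qed.

(** If [eps] exceeds 1 no set is requested; otherwise [eps <= 1] is recovered from any index
    [i < K]. *)
Lemma output_sets_good :
  good_sets H k eps (cheeger_constant * cheeger_bound H k eps xi)
    [seq output_set H fs eps i | i <- iota 0 (Num.truncn ((1 - eps) * k%:R))].
Proof.
set K := Num.truncn _.
have xi0 : 0 <= xi.
  apply: le_trans (fs_discrepancy (Ordinal k_gt0)).
  rewrite divr_ge0 ?sumr_ge0 // => [e ee|u _].
    by rewrite mulr_ge0 ?weight_ge0 ?edge_max_ge0.
  by rewrite mulr_ge0 ?sqr_ge0 // ltW // vweight_gt0.
have size_ok i : (i < K)%N -> i.+1%:R <= (1 - eps) * k%:R by rewrite truncn_gt_nat.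
have good i : (i < K)%N -> output_set H fs eps i != finset.set0 /\
    expansion H (output_set H fs eps i) <= cheeger_constant * cheeger_bound H k eps xi.
  move=> /size_ok ik; have ge1 : 1 <= (1 - eps) * k%:R.
    by apply: le_trans ik; rewrite ler1n.
  have eps_le1 : eps <= 1.
    rewrite -subr_ge0 -(pmulr_lge0 _ kR_gt0); exact: le_trans ge1.
  have [t [t0 gt] ->] := output_set_cluster eps_gt0 eps_le1 keps fs_orthonormal.
  have [ne ex] := cluster_expansion eps_gt0 eps_le1 keps fs_orthonormal fs_discrepancy t0 gt ik.
  by split=> //; exact: expansion_le_cheeger.
apply/and4P; split.
- by rewrite size_map size_iota.
- by apply/allP => S /mapP[i]; rewrite mem_iota => /good[ne _] ->.
- rewrite pairwise_map; apply/(pairwiseP 0%N) => i j.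
  rewrite !inE size_iota => iK jK ij /=; rewrite !nth_iota // !add0n.
  have ge1 : 1 <= (1 - eps) * k%:R by apply: le_trans (size_ok _ iK); rewrite ler1n.
  have eps_le1 : eps <= 1.
    rewrite -subr_ge0 -(pmulr_lge0 _ kR_gt0); exact: le_trans ge1.
  have [t [t0 gt] tE] := output_set_cluster eps_gt0 eps_le1 keps fs_orthonormal.
  by rewrite !tE cluster_disjoint // neq_ltn ij.
by apply/allP => S /mapP[i]; rewrite mem_iota => /good[_ ex] ->.
Qed.

End Bound.

(** * The algorithm as an expression *)

(** Truth values are the reals 0 and 1: conjunction is the product, and existence the maximum. *)
Definition x_lt a b := EIf a b (ENat 1) (ENat 0).
Definition x_le a b := EIf b a (ENat 0) (ENat 1).
Definition x_not a := ESub (ENat 1) a.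
Definition x_sum d rg e := EBig false d rg e.
Definition x_max d rg e := EBig true d rg e.
Definition x_all d rg e := x_not (x_max d rg (x_not e)).
Definition x_abs e := ESqrt (EMul e e).
Definition x_sqr e := EMul e e.

(* Below, [d] is the first variable which is free for use as a bound variable. *)
Definition x_deg d v := x_sum d RgE (EMul (EWeight d) (EInc d v)).
Definition x_norm d v := ESqrt (x_sum d (RgK 0) (x_sqr (ECoord d v))).
Definition x_dir d s v := EDiv (ECoord s v) (x_norm d v).
Definition x_side := EDiv (ESqrt (EDiv EEps EDim)) (ENat 3).
Definition x_gap := EDiv (EMul x_side EEps) (EMul (ENat 5) EDim).
Definition x_shift a b := EAdd (EMul (EVar a) (EAdd EDim EDim)) (EVar b).
Definition x_wall a b i :=
  ESub (EAdd (EMul (x_shift a b) x_gap) (EMul (EVar i) x_side)) (ENat 1).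
Definition x_below d a b s i v := x_lt (x_dir d s v) (x_wall a b i).
Definition x_same_cell d a b u v :=
  x_all d (RgK 0) (x_all d.+1 (RgK 5)
    (EMul (x_le (x_below d.+2 a b d d.+1 u) (x_below d.+2 a b d d.+1 v))
          (x_le (x_below d.+2 a b d d.+1 v) (x_below d.+2 a b d d.+1 u)))).
Definition x_proximity d a b v :=
  x_max d (RgK 0) (x_max d.+1 (RgK 5)
    (ESub (ENat 1) (EDiv (EMul (x_abs (ESub (x_dir d.+2 d v) (x_wall a b d.+1))) (ENat 2))
                         x_gap))).
Definition x_height d a b v := EMul (x_norm d v) (ESub (ENat 1) (x_proximity d a b v)).
Definition x_height_mass d a b v := EMul (x_deg d v) (x_sqr (x_height d a b v)).
Definition x_good_shift d a b :=
  EMul (x_lt (EMul (x_shift a b) EEps) (EMul (ENat 4) EDim))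
       (x_le (EMul (ESub (ENat 1) (EDiv EEps (ENat 4))) EDim)
             (x_sum d RgV (x_height_mass d.+1 a b d))).
Definition x_cell_mass d a b v :=
  x_sum d RgV (EMul (x_same_cell d.+1 a b d v) (x_height_mass d.+1 a b d)).
Definition x_heavy d a b v := x_le (EDiv (ENat 1) (ENat 2)) (x_cell_mass d a b v).
Definition x_representative d a b v :=
  x_all d RgV (x_not (EMul (x_same_cell d.+1 a b d v) (x_lt (EVar d) (EVar v)))).
Definition x_load d a b v :=
  EIf (ENat 0) (x_heavy d a b v) (ENat 1) (x_cell_mass d a b v).
Definition x_key d a b v :=
  EAdd (EIf (ENat 0) (x_heavy d a b v) (ENat 0) EOrder) (EVar v).
Definition x_position d a b v :=
  x_sum d RgV (EMul (EMul (x_representative d.+1 a b d)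
                          (x_lt (x_key d.+1 a b d) (x_key d.+1 a b v)))
                    (x_load d.+1 a b d)).
Definition x_group d a b i v :=
  x_max d RgV (EMul (x_representative d.+1 a b d) (EMul (x_same_cell d.+1 a b v d)
    (EMul (x_le (EVar i) (x_position d.+1 a b d))
          (x_lt (x_position d.+1 a b d) (EAdd (EVar i) (ENat 1)))))).
Definition x_sweep d a b i z v :=
  EMul (x_group d a b i v) (x_le (x_height d a b z) (x_height d a b v)).
Definition x_cut d a b i z :=
  x_sum d RgE (EMul (EWeight d)
    (EMul (x_max d.+1 RgV (EMul (EInc d d.+1) (x_sweep d.+2 a b i z d.+1)))
          (x_max d.+1 RgV (EMul (EInc d d.+1) (x_not (x_sweep d.+2 a b i z d.+1)))))).
Definition x_volume d a b i z :=
  x_sum d RgV (EMul (x_deg d.+1 d) (x_sweep d.+1 a b i z d)).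
Definition x_expansion d a b i z := EDiv (x_cut d a b i z) (x_volume d a b i z).
Definition x_candidate d a b i z :=
  EMul (x_group d a b i z) (x_lt (ENat 0) (x_height d a b z)).
Definition x_best d a b i z :=
  EMul (x_candidate d a b i z)
       (x_all d RgV (x_not (EMul (x_candidate d.+1 a b i d)
          (x_lt (x_expansion d.+1 a b i d) (x_expansion d.+1 a b i z))))).
Definition x_cluster d a b i v :=
  EMul (x_group d a b i v)
       (x_max d RgV (EMul (x_best d.+1 a b i d)
                          (x_le (x_height d.+1 a b d) (x_height d.+1 a b v)))).
Definition x_chosen d a b :=
  EMul (x_good_shift d a b)
       (x_all d (RgK 1) (x_all d.+1 (RgK 1)
          (x_not (EMul (x_lt (x_shift d d.+1) (x_shift a b)) (x_good_shift d.+2 d d.+1))))).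
(** A fixed expression, hence one program for all inputs. Subexpressions are recomputed at each use;
    the cost stays polynomial because the nesting depth is constant. *)
Definition x_output d i v :=
  x_max d (RgK 1) (x_max d.+1 (RgK 1)
    (EMul (x_chosen d.+2 d d.+1) (x_cluster d.+2 d d.+1 i v))).

Lemma bigmax_bool (R : realType) (I : finType) (P : pred I) :
  \big[Num.max/0]_i (P i)%:R = [exists i, P i]%:R :> R.
Proof.
apply/le_anti/andP; split.
  apply: bigmax_le => // i _; rewrite ler_nat; case Pi: (P i) => //.
  by rewrite lt0b; apply/existsP; exists i.
case: existsP => [[i Pi]|_]; last exact: bigmax_ge_id.
by apply: (bigmax_sup i) => //; rewrite Pi.
Qed.

(** * The expressions evaluate to the objects they describe *)

Section ExpressionValues.
Variables (R : realType) (V : finType) (H : hypergraph R V).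
Variables (k : nat) (fs : k.-tuple (vec R V)) (eps : R).
Implicit Types (env : nat -> nat) (e : expr).
Let s0 := input H fs eps.

Definition ev env e (x : R) : Prop := eval s0 env e = x.
Definition holds env e (b : bool) : Prop := ev env e b%:R.
(** The condition [x < d] protects [x] from capture by the bound variables, which are numbered from
    [d] on. *)
Definition bound (d : nat) env (x i : nat) : Prop := (x < d)%N /\ env x = i.

Lemma bound_new d env i : bound d.+1 (set_var env d i) d i.
Proof. by split=> //; exact: set_var_eq. Qed.

Lemma bound_set d env x i j : bound d env x i -> bound d.+1 (set_var env d j) x i.
Proof.
by case=> lt e; split; [exact: ltnW | rewrite set_var_neq ?e // ltn_eqF].
Qed.

Lemma ev_nat env c : ev env (ENat c) c%:R. Proof. by []. Qed.
Lemma ev_var d env x i : bound d env x i -> ev env (EVar x) i%:R.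
Proof. by case=> _ <-. Qed.
Lemma ev_order env : ev env EOrder #|V|%:R. Proof. by []. Qed.
Lemma ev_dim env : ev env EDim k%:R. Proof. by []. Qed.
Lemma ev_eps env : ev env EEps eps. Proof. by []. Qed.

Lemma ev_weight d env x (i : 'I_#|edges H|) : bound d env x i ->
  ev env (EWeight x) (weight H (enum_val i)).
Proof.
case=> _ ei; rewrite /ev /= ei (nth_map finset.set0) -?cardE //.
by rewrite (enum_val_nth finset.set0).
Qed.

Lemma ev_coord d env x y (s : 'I_k) (v : V) :
  bound d env x s -> bound d env y (enum_rank v) -> ev env (ECoord x y) (coord fs s v).
Proof.
case=> _ es [_ ey]; rewrite /ev /= es ey (nth_map v) -?cardE ?nth_enum_rank //.
by rewrite /coord (tnth_nth 0).
Qed.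

Lemma holds_inc d env x y (i : 'I_#|edges H|) (v : V) :
  bound d env x i -> bound d env y (enum_rank v) ->
  holds env (EInc x y) (v \in enum_val i).
Proof.
case=> _ ei [_ ey]; rewrite /holds /ev /= ei ey (nth_map v) -?cardE ?nth_enum_rank //.
by rewrite (enum_val_nth finset.set0).
Qed.

Lemma ev_add env e1 e2 x y : ev env e1 x -> ev env e2 y -> ev env (EAdd e1 e2) (x + y).
Proof. by rewrite /ev /= => -> ->. Qed.
Lemma ev_sub env e1 e2 x y : ev env e1 x -> ev env e2 y -> ev env (ESub e1 e2) (x - y).
Proof. by rewrite /ev /= => -> ->. Qed.
Lemma ev_mul env e1 e2 x y : ev env e1 x -> ev env e2 y -> ev env (EMul e1 e2) (x * y).
Proof. by rewrite /ev /= => -> ->. Qed.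
Lemma ev_div env e1 e2 x y : ev env e1 x -> ev env e2 y -> ev env (EDiv e1 e2) (x / y).
Proof. by rewrite /ev /= => -> ->. Qed.
Lemma ev_sqrt env e x : ev env e x -> ev env (ESqrt e) (Num.sqrt x).
Proof. by rewrite /ev /= => ->. Qed.
Lemma ev_sqr env e x : ev env e x -> ev env (x_sqr e) (x ^+ 2).
Proof. by rewrite expr2 => ?; exact: ev_mul. Qed.
Lemma ev_abs env e x : ev env e x -> ev env (x_abs e) `|x|.
Proof. by rewrite -sqrtr_sqr => ?; exact/ev_sqrt/ev_sqr. Qed.

Lemma ev_if env e1 e2 b x y : holds env e1 b -> ev env e2 x -> forall e3, ev env e3 y ->
  ev env (EIf (ENat 0) e1 e2 e3) (if b then x else y).
Proof. by rewrite /holds /ev /= => -> -> e3 ->; rewrite ltr0n lt0b. Qed.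

Lemma holds_lt env e1 e2 x y : ev env e1 x -> ev env e2 y ->
  holds env (x_lt e1 e2) (x < y).
Proof. by rewrite /holds /ev /= => -> ->; case: (x < y). Qed.
Lemma holds_le env e1 e2 x y : ev env e1 x -> ev env e2 y ->
  holds env (x_le e1 e2) (x <= y).
Proof. by rewrite /holds /ev /= => -> ->; case: ltP. Qed.
Lemma holds_and env e1 e2 b c : holds env e1 b -> holds env e2 c ->
  holds env (EMul e1 e2) (b && c).
Proof. by rewrite /holds /ev /= => -> ->; rewrite -natrM mulnb. Qed.
Lemma holds_not env e b : holds env e b -> holds env (x_not e) (~~ b).
Proof. by rewrite /holds /ev /= => ->; case: b; rewrite ?subrr ?subr0. Qed.

Lemma ev_sumV d env e (g : V -> R) :
  (forall v, ev (set_var env d (enum_rank v)) e (g v)) -> ev env (x_sum d RgV e) (\sum_v g v).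
Proof.
move=> h; rewrite /ev /= (reindex (@enum_rank V)) /=; last exact/onW_bij/enum_rank_bij.
by apply: eq_bigr => v _; exact: h.
Qed.

Lemma ev_sumE d env e (g : {set V} -> R) :
  (forall i : 'I_#|edges H|, ev (set_var env d i) e (g (enum_val i))) ->
  ev env (x_sum d RgE e) (\sum_(f in edges H) g f).
Proof.
move=> h; rewrite /ev big_enum_val /=.
by apply: eq_bigr => i _; exact: h.
Qed.

Lemma ev_sumO n d env c e (g : 'I_n -> R) : range_size s0 (RgK c) = n ->
  (forall i : 'I_n, ev (set_var env d i) e (g i)) ->
  ev env (x_sum d (RgK c) e) (\sum_(i < n) g i).
Proof.
move=> en; rewrite -en in g * => h; apply: eq_bigr => i _; exact: h.
Qed.

Lemma ev_maxO n d env c e (g : 'I_n -> R) : range_size s0 (RgK c) = n ->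
  (forall i : 'I_n, ev (set_var env d i) e (g i)) ->
  ev env (x_max d (RgK c) e) (\big[Num.max/0]_(i < n) g i).
Proof.
move=> en; rewrite -en in g * => h; apply: eq_bigr => i _; exact: h.
Qed.

Lemma holds_existsV d env e (P : pred V) :
  (forall v, holds (set_var env d (enum_rank v)) e (P v)) ->
  holds env (x_max d RgV e) [exists v, P v].
Proof.
move=> h; rewrite /holds /ev /=.
rewrite (eq_bigr (fun i : 'I_#|V| => (P (enum_val i))%:R)) => [|i _]; last first.
  by have := h (enum_val i); rewrite enum_valK.
rewrite bigmax_bool; congr (nat_of_bool _)%:R.
apply/existsP/existsP => [[i Pi]|[v Pv]]; first by exists (enum_val i).
by exists (enum_rank v); rewrite enum_rankK.
Qed.

Lemma holds_existsO n d env c e (P : pred 'I_n) : range_size s0 (RgK c) = n ->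
  (forall i : 'I_n, holds (set_var env d i) e (P i)) ->
  holds env (x_max d (RgK c) e) [exists i, P i].
Proof.
by move=> en h; rewrite /holds -bigmax_bool; exact: ev_maxO.
Qed.

Lemma holds_allV d env e (P : pred V) :
  (forall v, holds (set_var env d (enum_rank v)) e (P v)) ->
  holds env (x_all d RgV e) [forall v, P v].
Proof.
move=> h; rewrite -[[forall v, P v]]negbK negb_forall.
by apply/holds_not/holds_existsV => v; exact: holds_not.
Qed.

Lemma holds_allO n d env c e (P : pred 'I_n) : range_size s0 (RgK c) = n ->
  (forall i : 'I_n, holds (set_var env d i) e (P i)) ->
  holds env (x_all d (RgK c) e) [forall i, P i].
Proof.
move=> en h; rewrite -[[forall v, P v]]negbK negb_forall.
by apply/holds_not/holds_existsO => // v; exact: holds_not.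
Qed.

Ltac bounds := solve [repeat first [eassumption | exact: bound_new | apply: bound_set]].

Lemma ev_deg d env x v : bound d env x (enum_rank v) ->
  ev env (x_deg d x) (vweight H v).
Proof.
move=> bx; rewrite /vweight big_mkcondr /=.
apply: ev_sumE => i; rewrite -mulrb.
have := ev_mul (ev_weight (bound_new d env i)) (holds_inc (bound_new d env i) (bound_set i bx)).
by rewrite mulr_natr.
Qed.

Lemma ev_norm d env x v : bound d env x (enum_rank v) ->
  ev env (x_norm d x) (norm fs v).
Proof.
move=> bx; apply/ev_sqrt/(@ev_sumO k) => // s; apply: ev_sqr.
by apply: (@ev_coord d.+1); bounds.
Qed.

Lemma ev_dir d env x y (s : 'I_k) v : bound d env x s -> bound d env y (enum_rank v) ->
  ev env (x_dir d x y) (dir fs s v).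
Proof. by move=> bx by_; apply: ev_div; [exact: ev_coord bx by_ | exact: ev_norm]. Qed.

Lemma ev_side env : ev env x_side (side k eps).
Proof. by []. Qed.

Lemma ev_gap env : ev env x_gap (gap k eps).
Proof. by []. Qed.

Section Shifted.
Variables (A B : nat).
Local Notation t := (shift R k A B).

Lemma ev_shift d env a b : bound d env a A -> bound d env b B -> ev env (x_shift a b) t.
Proof.
move=> ba bb; apply: ev_add (ev_var bb).
by rewrite natrD; apply: ev_mul (ev_var ba) _; apply: ev_add; exact: ev_dim.
Qed.

Lemma ev_wall d env a b x i : bound d env a A -> bound d env b B -> bound d env x i ->
  ev env (x_wall a b x) (wall k eps t i).
Proof.
move=> ba bb bx; apply: ev_sub (ev_nat _ _); apply: ev_add.
  by apply: ev_mul (ev_gap _); exact: ev_shift ba bb.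
by apply: ev_mul (ev_side _); exact: ev_var bx.
Qed.

Lemma holds_below d env a b x y z (s : 'I_k) i v :
  bound d env a A -> bound d env b B -> bound d env x s -> bound d env y i ->
  bound d env z (enum_rank v) -> holds env (x_below d a b x y z) (below fs eps t s i v).
Proof.
move=> ba bb bx by_ bz; apply: holds_lt; first exact: ev_dir.
exact: ev_wall ba bb by_.
Qed.

Lemma holds_same_cell d env a b x y u v : bound d env a A -> bound d env b B ->
  bound d env x (enum_rank u) -> bound d env y (enum_rank v) ->
  holds env (x_same_cell d a b x y) (same_cell fs eps t u v).
Proof.
move=> ba bb bx by_; apply: (@holds_allO k) => // s.
apply: (@holds_allO (wall_count k)) => // i.
(* Equality of truth values is tested by comparing 0 and 1 in both directions. *)
rewrite (_ : (_ == _) = ((below fs eps t s i u)%:R <= (below fs eps t s i v)%:R :> R) &&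
  ((below fs eps t s i v)%:R <= (below fs eps t s i u)%:R :> R)); last first.
  by rewrite !ler_nat; case: below; case: below.
by apply: holds_and; apply: holds_le; apply: holds_below; bounds.
Qed.

Lemma ev_proximity d env a b x v : bound d env a A -> bound d env b B ->
  bound d env x (enum_rank v) -> ev env (x_proximity d a b x) (proximity fs eps t v).
Proof.
move=> ba bb bx; apply: (@ev_maxO k) => // s.
apply: (@ev_maxO (wall_count k)) => // i.
apply: ev_sub (ev_nat _ _) _; apply: ev_div (ev_gap _); apply: ev_mul (ev_nat _ _).
apply/ev_abs/ev_sub; first by apply: ev_dir; bounds.
by apply: (@ev_wall d.+2); bounds.
Qed.

Lemma ev_height d env a b x v : bound d env a A -> bound d env b B ->
  bound d env x (enum_rank v) -> ev env (x_height d a b x) (height fs eps t v).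
Proof.
move=> ba bb bx; apply: ev_mul; first exact: ev_norm.
by apply: ev_sub (ev_nat _ _) _; exact: ev_proximity.
Qed.

Lemma ev_height_mass d env a b x v : bound d env a A -> bound d env b B ->
  bound d env x (enum_rank v) -> ev env (x_height_mass d a b x) (height_mass H fs eps t v).
Proof.
by move=> ba bb bx; apply: ev_mul; [exact: ev_deg | apply/ev_sqr/ev_height].
Qed.

Lemma holds_good_shift d env a b : bound d env a A -> bound d env b B ->
  holds env (x_good_shift d a b) (good_shift H fs eps t).
Proof.
move=> ba bb; apply: holds_and.
  apply: holds_lt; first by apply: ev_mul (ev_eps _); exact: ev_shift ba bb.
  by apply: ev_mul (ev_nat _ _) (ev_dim _).
apply: holds_le.
  apply: ev_mul (ev_dim _); apply: ev_sub (ev_nat _ _) _.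
  exact: ev_div (ev_eps _) (ev_nat _ _).
by apply: ev_sumV => v; apply: ev_height_mass; bounds.
Qed.

Lemma ev_cell_mass d env a b x v : bound d env a A -> bound d env b B ->
  bound d env x (enum_rank v) -> ev env (x_cell_mass d a b x) (cell_mass H fs eps t v).
Proof.
move=> ba bb bx; rewrite /cell_mass big_mkcond; apply: ev_sumV => u.
rewrite (_ : (if _ then _ else _) = (same_cell fs eps t u v)%:R * height_mass H fs eps t u).
  by apply: ev_mul; [apply: holds_same_cell | apply: ev_height_mass]; bounds.
by case: ifP; rewrite ?mul1r ?mul0r.
Qed.

Lemma holds_heavy d env a b x v : bound d env a A -> bound d env b B ->
  bound d env x (enum_rank v) -> holds env (x_heavy d a b x) (heavy H fs eps t v).
Proof.
move=> ba bb bx; apply: holds_le; first exact: ev_div (ev_nat _ _) (ev_nat _ _).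
exact: ev_cell_mass.
Qed.

Lemma holds_representative d env a b x v : bound d env a A -> bound d env b B ->
  bound d env x (enum_rank v) ->
  holds env (x_representative d a b x) (representative fs eps t v).
Proof.
move=> ba bb bx; apply: holds_allV => u; rewrite implybE leqNgt -negb_and.
apply/holds_not/holds_and; first by apply: holds_same_cell; bounds.
rewrite -(ltr_nat R); apply: holds_lt; first exact/ev_var/bound_new.
by apply: (@ev_var d.+1); bounds.
Qed.

Lemma ev_load d env a b x v : bound d env a A -> bound d env b B ->
  bound d env x (enum_rank v) -> ev env (x_load d a b x) (load H fs eps t v).
Proof.
move=> ba bb bx; apply: ev_if; [exact: holds_heavy | exact: ev_nat | exact: ev_cell_mass].
Qed.

Lemma ev_key d env a b x v : bound d env a A -> bound d env b B ->
  bound d env x (enum_rank v) -> ev env (x_key d a b x) (key H fs eps t v)%:R.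
Proof.
move=> ba bb bx; rewrite /key natrD; apply: ev_add (ev_var bx).
rewrite (fun_if (fun n => n%:R)).
by apply: ev_if; [exact: holds_heavy | exact: ev_nat | exact: ev_order].
Qed.

Lemma ev_position d env a b x v : bound d env a A -> bound d env b B ->
  bound d env x (enum_rank v) -> ev env (x_position d a b x) (position H fs eps t v).
Proof.
move=> ba bb bx; rewrite /position big_mkcond; apply: ev_sumV => u.
rewrite (_ : (if _ then _ else _) = (representative fs eps t u &&
   ((key H fs eps t u)%:R < (key H fs eps t v)%:R :> R))%:R * load H fs eps t u).
  apply: ev_mul; last by apply: ev_load; bounds.
  apply: holds_and; first by apply: holds_representative; bounds.
  by apply: holds_lt; apply: ev_key; bounds.
by rewrite ltr_nat; case: ifP; rewrite ?mul1r ?mul0r.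
Qed.

Lemma holds_group d env a b y x i v : bound d env a A -> bound d env b B ->
  bound d env y i -> bound d env x (enum_rank v) ->
  holds env (x_group d a b y x) (v \in group H fs eps t i).
Proof.
move=> ba bb by_ bx; rewrite inE; apply: holds_existsV => r.
apply: holds_and; first by apply: holds_representative; bounds.
apply: holds_and; first by apply: holds_same_cell; bounds.
have bi : bound d.+1 (set_var env d (enum_rank r)) y i by bounds.
apply: holds_and.
  by apply: holds_le; [exact: ev_var bi | apply: ev_position; bounds].
apply: holds_lt; first by apply: ev_position; bounds.
by rewrite -natr1; apply: ev_add (ev_nat _ _); exact: ev_var bi.
Qed.

Section Sweep.
Variables (d : nat) (env : nat -> nat) (a b y x : nat) (i : nat) (z : V).
Hypotheses (ba : bound d env a A) (bb : bound d env b B) (by_ : bound d env y i)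
  (bx : bound d env x (enum_rank z)).

Lemma holds_candidate : holds env (x_candidate d a b y x) (candidate H fs eps t i z).
Proof.
apply: holds_and; first exact: holds_group.
by apply: holds_lt (ev_nat _ _) _; exact: ev_height.
Qed.

Lemma holds_sweep x' v : bound d env x' (enum_rank v) ->
  holds env (x_sweep d a b y x x') (v \in sweep_set H fs eps t i z).
Proof.
move=> bx'; rewrite inE; apply: holds_and; first exact: holds_group.
by apply: holds_le; exact: ev_height.
Qed.

End Sweep.

Lemma ev_cut d env a b y x i z : bound d env a A -> bound d env b B ->
  bound d env y i -> bound d env x (enum_rank z) ->
  ev env (x_cut d a b y x) (cut H (sweep_set H fs eps t i z)).
Proof.
move=> ba bb by_ bx; rewrite cutE; set S := sweep_set _ _ _ _ _ _.
rewrite (eq_bigr (fun f : {set V} => weight H f *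
  ([exists v, (v \in f) && (v \in S)] && [exists v, (v \in f) && (v \notin S)])%:R)); last first.
  move=> e ee; congr (_ * (nat_of_bool _)%:R).
  apply/boundaryP/andP => [[_ [u ue uS] [v ve vS]]|[/existsP[u /andP[ue uS]] /existsP[v /andP[ve vS]]]].
    by split; apply/existsP; [exists u; rewrite ue | exists v; rewrite ve].
  by split=> //; [exists u | exists v].
apply: (@ev_sumE _ _ _ (fun f : {set V} => weight H f *
  ([exists v, (v \in f) && (v \in S)] && [exists v, (v \in f) && (v \notin S)])%:R)) => e.
apply: ev_mul; first exact/ev_weight/bound_new.
apply: holds_and; apply: holds_existsV => v; apply: holds_and.
- by apply: (@holds_inc d.+2); bounds.
- by apply: holds_sweep; bounds.
- by apply: (@holds_inc d.+2); bounds.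
- by apply: holds_not; apply: holds_sweep; bounds.
Qed.

Lemma ev_expansion d env a b y x i z : bound d env a A -> bound d env b B ->
  bound d env y i -> bound d env x (enum_rank z) ->
  ev env (x_expansion d a b y x) (expansion H (sweep_set H fs eps t i z)).
Proof.
move=> ba bb by_ bx; apply: ev_div; first exact: ev_cut.
rewrite /volume big_mkcond; apply: ev_sumV => v.
rewrite (_ : (if _ then _ else _) =
  vweight H v * (v \in sweep_set H fs eps t i z)%:R).
  by apply: ev_mul; [apply: ev_deg | apply: holds_sweep]; bounds.
by case: ifP; rewrite ?mulr1 ?mulr0.
Qed.

Lemma holds_best d env a b y x i z : bound d env a A -> bound d env b B ->
  bound d env y i -> bound d env x (enum_rank z) ->
  holds env (x_best d a b y x) (best H fs eps t i z).
Proof.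
move=> ba bb by_ bx; apply: holds_and; first exact: holds_candidate.
apply: holds_allV => z'; rewrite implybE leNgt -negb_and.
apply/holds_not/holds_and; first by apply: holds_candidate; bounds.
by apply: holds_lt; apply: ev_expansion; bounds.
Qed.

Lemma holds_cluster d env a b y x i v : bound d env a A -> bound d env b B ->
  bound d env y i -> bound d env x (enum_rank v) ->
  holds env (x_cluster d a b y x) (v \in cluster H fs eps t i).
Proof.
move=> ba bb by_ bx; rewrite inE; apply: holds_and; first exact: holds_group.
apply: holds_existsV => z; apply: holds_and; first by apply: holds_best; bounds.
by apply: holds_le; apply: ev_height; bounds.
Qed.

End Shifted.

Lemma holds_chosen A B d env a b : bound d env a A -> bound d env b B ->
  holds env (x_chosen d a b) (chosen H fs eps A B).
Proof.
move=> ba bb; apply: holds_and; first exact: holds_good_shift.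
apply: (@holds_allO (k + k)) => // a'; apply: (@holds_allO (k + k)) => // b'.
rewrite implybE -negb_and; apply/holds_not/holds_and.
  by apply: holds_lt; apply: (@ev_shift _ _ d.+2); bounds.
by apply: holds_good_shift; bounds.
Qed.

Lemma holds_output d env y x i v : bound d env y i -> bound d env x (enum_rank v) ->
  holds env (x_output d y x) (v \in output_set H fs eps i).
Proof.
move=> by_ bx; rewrite inE.
apply: (@holds_existsO (k + k)) => // a; apply: (@holds_existsO (k + k)) => // b.
by apply: holds_and; [apply: holds_chosen | apply: holds_cluster]; bounds.
Qed.

End ExpressionValues.

(** * Indicators of disjoint sets *)

Section Indicators.
Variables (R : realType) (V : finType) (H : hypergraph R V) (k : nat).
Variable S : 'I_k -> {set V}.
Hypotheses (S_neq0 : forall i, S i != finset.set0)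
  (S_disjoint : forall i j, i != j -> [disjoint S i & S j]).

Definition indicator (A : {set V}) : vec R V := [ffun v => (v \in A)%:R].
Definition indicators : k.-tuple (vec R V) := [tuple indicator (S i) | i < k].

Lemma disjoint_mem i j v : v \in S i -> v \in S j -> i = j.
Proof.
move=> vi vj; apply/eqP; apply: contraTT isT => /S_disjoint/pred0P/(_ v).
by rewrite /= vi vj.
Qed.

Lemma indicators_orthogonal : nonzero_orthogonal H indicators.
Proof.
split=> [i|i j ij]; rewrite !tnth_mktuple.
  have /set0Pn[v vi] := S_neq0 i; apply/eqP => /ffunP/(_ v).
  by rewrite !ffunE vi => /eqP; rewrite oner_eq0.
rewrite /inner big1 // => v _; rewrite !ffunE.
case: (boolP (v \in S i)) => vi; rewrite ?mulr0 ?mul0r //.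
case: (boolP (v \in S j)) => vj; rewrite ?mulr0 //.
by rewrite (disjoint_mem vi vj) eqxx in ij.
Qed.

Lemma span_indicators (f : vec R V) : f \in <<indicators>>%VS ->
  exists c : 'I_k -> R, forall v, f v = \sum_i c i * (v \in S i)%:R.
Proof.
move=> /coord_span fE; exists (fun i => vector.coord indicators i f) => v.
rewrite [in LHS]fE sum_ffunE; apply: eq_bigr => i _.
by rewrite ffunE -tnth_nth tnth_mktuple ffunE.
Qed.

Lemma sum_indicators (c : 'I_k -> R) i v : v \in S i ->
  \sum_j c j * (v \in S j)%:R = c i.
Proof.
move=> vi; rewrite (bigD1 i) //= vi mulr1 big1 ?addr0 // => j ji.
case: (boolP (v \in S j)) => vj; rewrite ?mulr0 //.
by rewrite (disjoint_mem vi vj) eqxx in ji.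
Qed.

Lemma volumeE (A : {set V}) : volume H A = \sum_v vweight H v * (v \in A)%:R.
Proof.
rewrite /volume big_mkcond; apply: eq_bigr => v _.
by case: ifP; rewrite ?mulr1 ?mulr0.
Qed.

Lemma expansion_volume i : expansion H (S i) * volume H (S i) = cut H (S i).
Proof.
have /set0Pn[v vi] := S_neq0 i.
by rewrite /expansion divfK // gt_eqF // (volume_gt0 H vi).
Qed.

(** [f] is constant on each [S i] and 0 elsewhere. On a hyperedge, [(f u - f v) ^+ 2] is at most the
    sum of [2 * c i ^+ 2] over the [S i] that cut it; summing gives cuts, which are expansions times
    volumes. *)
Lemma discrepancy_span (f : vec R V) : f \in <<indicators>>%VS ->
  discrepancy H f <= 2 * \big[Num.max/0]_(i < k) expansion H (S i).
Proof.
move=> /span_indicators[c fE]; set phi := \big[_/_]_(i < k) _.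
have phi0 : 0 <= phi by exact: bigmax_ge_id.
have den : \sum_u vweight H u * f u ^+ 2 = \sum_i c i ^+ 2 * volume H (S i).
  under [RHS]eq_bigr do rewrite volumeE mulr_sumr.
  rewrite exchange_big /=; apply: eq_bigr => v _.
  have [i vi|none] := pickP (fun i => v \in S i).
    rewrite fE (sum_indicators _ vi).
    under eq_bigr do rewrite mulrCA.
    by rewrite -mulr_sumr (sum_indicators (fun i => c i ^+ 2) vi).
  rewrite fE big1 => [|i _]; last by rewrite none mulr0.
  by rewrite expr0n mulr0 big1 // => i _; rewrite none !mulr0.
(* A vanishing denominator makes the quotient nonpositive, so the bound holds trivially. *)
have [den0|den0] := leP (\sum_u vweight H u * f u ^+ 2) 0.
  apply: (@le_trans _ _ 0); last by rewrite mulr_ge0.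
  rewrite /discrepancy mulr_ge0_le0 ?invr_le0 // sumr_ge0 // => e ee.
  by rewrite mulr_ge0 ?weight_ge0 ?edge_max_ge0.
rewrite /discrepancy ler_pdivrMr // den mulr_sumr.
have num : \sum_(e in edges H) weight H e * edge_max f e <= \sum_i 2 * c i ^+ 2 * cut H (S i).
  under [leRHS]eq_bigr do rewrite cutE mulr_sumr.
  rewrite exchange_big /=; apply: ler_sum => e ee.
  have -> : \sum_i 2 * c i ^+ 2 * (weight H e * (e \in boundary H (S i))%:R) =
      weight H e * \sum_i 2 * c i ^+ 2 * (e \in boundary H (S i))%:R.
    by rewrite mulr_sumr; apply: eq_bigr => i _; rewrite mulrCA.
  rewrite ler_wpM2l ?weight_ge0 //; set B := \sum_i _.
  have term_ge0 i : 0 <= 2 * c i ^+ 2 * (e \in boundary H (S i))%:R.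
    by rewrite mulr_ge0 // mulr_ge0 // sqr_ge0.
  have B0 : 0 <= B by exact: sumr_ge0.
  have B1 i : e \in boundary H (S i) -> 2 * c i ^+ 2 <= B.
    move=> ei; rewrite /B (bigD1 i) //= ei mulr1 lerDl sumr_ge0 //.
  have B2 i j : i != j -> e \in boundary H (S i) -> e \in boundary H (S j) ->
      2 * c i ^+ 2 + 2 * c j ^+ 2 <= B.
    move=> ij ei ej; rewrite /B (bigD1 i) //= ei mulr1 lerD2l.
    by rewrite (bigD1 j) 1?eq_sym //= ej mulr1 lerDl sumr_ge0.
  apply: bigmax_le => // u ue; apply: bigmax_le => // v ve.
  have one i w w' : w \in e -> w' \in e -> w \in S i -> w' \notin S i -> e \in boundary H (S i).
    by move=> we we' wi wi'; apply/boundaryP; split=> //; [exists w | exists w'].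
  (* If [u] and [v] lie in different sets, both sets cut [e] and contribute separately; if only one
     lies in some set, that set cuts [e]. *)
  have [i ui|nu] := pickP (fun i => u \in S i); have [j vj|nv] := pickP (fun i => v \in S i).
  - rewrite !fE (sum_indicators _ ui) (sum_indicators _ vj).
    have [->|ij] := eqVneq i j; first by rewrite subrr expr0n.
    have ei : e \in boundary H (S i).
      by apply: one ue ve ui _; apply: contra ij => vi; rewrite (disjoint_mem vi vj).
    have ej : e \in boundary H (S j).
      by apply: one ve ue vj _; apply: contra ij => uj; rewrite (disjoint_mem ui uj).
    apply: le_trans (B2 i j ij ei ej).
    by have := sqr_ge0 (c i + c j); rewrite !expr2; lra.
  - have ei : e \in boundary H (S i) by apply: one ue ve ui _; rewrite nv.
    rewrite !fE (sum_indicators _ ui) big1 ?subr0 => [|j _]; last by rewrite nv mulr0.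
    by apply: le_trans (B1 i ei); have := sqr_ge0 (c i); lra.
  - have ej : e \in boundary H (S j) by apply: one ve ue vj _; rewrite nu.
    rewrite !fE (sum_indicators _ vj) big1 ?sub0r ?sqrrN => [|i _]; last by rewrite nu mulr0.
    by apply: le_trans (B1 j ej); have := sqr_ge0 (c j); lra.
  rewrite !fE !big1 ?subr0 ?expr0n // => i _; by rewrite ?nu ?nv mulr0.
apply: le_trans num _; apply: ler_sum => i _.
rewrite -expansion_volume -mulrA [leRHS]mulrA.
rewrite [leRHS](_ : _ = 2 * (c i ^+ 2 * (phi * volume H (S i)))); last by ring.
rewrite ler_wpM2l // ler_wpM2l ?sqr_ge0 // ler_wpM2r //.
  by apply: sumr_ge0 => v _; exact/ltW/vweight_gt0.
exact: (le_bigmax _ (fun i => expansion H (S i))).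
Qed.

Lemma zeta_le_expansion : (0 < k)%N ->
  zeta H k / 2 <= \big[Num.max/0]_(i < k) expansion H (S i).
Proof.
move=> k0; rewrite ler_pdivrMr // mulrC.
have disc_ge0 (f : vec R V) : 0 <= discrepancy H f.
  rewrite divr_ge0 // sumr_ge0 // => [e ee|v _].
    by rewrite mulr_ge0 ?weight_ge0 ?edge_max_ge0.
  by rewrite mulr_ge0 ?sqr_ge0 // ltW // vweight_gt0.
(* Nonnegativity supplies the lower bound needed for the infimum; a set without supremum has [sup]
   equal to 0. *)
have max_ge0 (fs : k.-tuple (vec R V)) : 0 <= max_discrepancy H fs.
  rewrite /max_discrepancy; set X := (X in sup X).
  have [hs|no] := pselect (has_sup X); last by rewrite sup_out.
  have [[x Xx] ub] := hs; apply: le_trans (ub_le_sup ub Xx).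
  by case: Xx => f [_ _ ->].
apply: (@le_trans _ _ (max_discrepancy H indicators)).
  apply: ge_inf; last by exists indicators; split=> //; exact: indicators_orthogonal.
  by exists 0 => x [fs [_ ->]].
apply: ge_sup => [|x [f [_ fi ->]]]; last exact: discrepancy_span.
(* The set under the supremum is nonempty because [0 < k]. *)
exists (discrepancy H (tnth indicators (Ordinal k0))), (tnth indicators (Ordinal k0)).
split=> //; first by have [nz _] := indicators_orthogonal.
exact/memv_span/mem_tnth.
Qed.

End Indicators.

(** * The polynomial-time procedure and the lower bound by [zeta], put together *)

Theorem mainTheorem10 (R : realType) :
  (exists (P : cmd) (a d : nat) (C p : R),
    [/\ 0 < C, 0 < p &
      forall (V : finType) (H : hypergraph R V) (k : nat)
             (fs : k.-tuple (vec R V)) (xi eps : R),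
        (0 < k)%N ->
        orthonormal_family H fs ->
        (forall s : 'I_k, discrepancy H (tnth fs s) <= xi) ->
        1 / k%:R <= eps ->
        let t := (a * input_size H k ^ d)%N in
        (forall w : t.-tuple bool, halted (run P (input H fs eps) t w)) /\
        p <= coin_probability R t (fun w =>
               good_sets H k eps (C * cheeger_bound H k eps xi)
                 (output V (cur_store (run P (input H fs eps) t w))))])
  /\
  (forall (V : finType) (H : hypergraph R V) (k : nat) (S : 'I_k -> {set V}),
     (0 < k)%N ->
     (forall i, S i != finset.set0) ->
     (forall i j, i != j -> [disjoint S i & S j]) ->
     zeta H k / 2 <= \big[Num.max/0]_(i < k) expansion H (S i)).
Proof.
split=> [|V H k S k0 S0 Sdisj]; last exact: zeta_le_expansion.
pose member := x_output 2 0 1.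
have [a [d cost_le]] := polynomial_program_cost member.
(* The program flips no coin, so it succeeds on every tape and the probability can be taken to be
   1. *)
exists (program member), a, d, (cheeger_constant R), 1; split=> //.
  exact: cheeger_constant_gt0.
move=> V H k fs xi eps k0 ortho disc eps_ge /=; set t := (a * _)%N.
have N0 : (0 < input_size H k)%N by rewrite /input_size addn_gt0 k0 orbT.
have eps0 : 0 <= eps by apply: le_trans eps_ge; rewrite divr_ge0.
(* The program handles indices, so membership is extended by [false] to numbers that index no
   vertex. *)
pose P i j := if insub j is Some v then enum_val (v : 'I_#|V|) \in output_set H fs eps i
              else false.
have memberE env : (env 0 < k)%N -> (env 1 < #|V|)%N ->
    eval (input H fs eps) env member = (P (env 0%N) (env 1%N))%:R.
  move=> _ lt1; rewrite /P insubT /=.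
  apply: (@holds_output R V H k fs eps 2 env 0 1 (env 0%N) _); split=> //.
  by rewrite enum_valK.
have le_order : (#|V| <= input_size H k)%N by rewrite /input_size -addnA leq_addr.
have le_edges : (#|edges H| <= input_size H k)%N.
  by rewrite /input_size addnAC leq_addl.
have le_dim : (k <= input_size H k)%N by rewrite leq_addl.
have ex := @exec_program R (input H fs eps) (input_size H k) member P
  le_order le_edges le_dim memberE (fun _ _ => erefl) eps erefl eps0.
have runP w := exec_run w ex (cost_le _ N0).
split=> [w|]; first by have [] := runP w.
rewrite /coin_probability (_ : finset _ = [set: t.-tuple bool]%SET).
  by rewrite cardsT card_tuple card_bool natrX divff ?lexx // expf_neq0 // pnatr_eq0.
apply/setP => w; rewrite !inE; have [_ [count row]] := runP w.
rewrite /output count; have := output_sets_good k0 ortho disc eps_ge.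
set K := Num.truncn _; set good := good_sets _ _ _ _.
have leKk : (K <= k)%N.
  rewrite truncn_le_nat (@le_lt_trans _ _ k%:R) ?ltr_nat //.
  by rewrite mulrBl mul1r gerBl mulr_ge0.
suff -> : [seq output_set H fs eps i | i <- iota 0 K] =
   [seq [set v | nmem (cur_store (run (program member) (input H fs eps) t w)) 1 i (enum_rank v) != 0%N]%SET
   | i <- iota 0 K] by [].
apply/eq_in_map => i; rewrite mem_iota => /andP[_ iK] /=; apply/setP => v; rewrite [RHS]inE.
rewrite row //; last exact: leq_trans iK leKk.
by rewrite /P (valK (enum_rank v)) enum_rankK; case: (v \in _).
Qed.
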